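(* Let $(W,S)$ be a finitely generated Coxeter system and $\Lambda=\Lambda(W,S)$ its Cayley graph. For all real constants $\lambda>0$, $\epsilon\ge0$ and every integer $B\ge 0$ there is a constant $K'$, depending only on $\lambda,\epsilon,B$ and $(W,S)$, such that every infinite (ray) or bi-infinite (line) $(\lambda,\epsilon)$-quasi-geodesic edge path $\alpha$ in $\Lambda$ with bounded bracket number $B(\alpha)=B$ is $K'$-tracked by a geodesic edge path in $\Lambda$.
   Context: A Coxeter system $(W,S)$ is a group $W$ with generating set $S$ and presentation $\langle S : (s_is_j)^{m(i,j)}\rangle$, where $m(i,j)=m(j,i)\in\{1,2,\ldots,\infty\}$, $m(i,j)=1$ iff $i=j$, and the relation is omitted if $m(i,j)=\infty$; it is finitely generated if $S$ is finite. The Cayley graph $\Lambda(W,S)$ has vertex set $W$ and, for each $w\in W$, $s\in S$, a single edge of length 1 labeled $s$ joining $w$ and $ws$; $d$ is the path metric, and $W$ acts on the left. A reflection is a conjugate in $W$ of an element of $S$. The wall $Q$ of a reflection is the set of edges of $\Lambda$ that are mapped to themselves (set-wise, with end vertices interchanged) by that reflection. Each edge belongs to exactly one wall. A finite edge path is a continuous map $\beta:[0,n]\to\Lambda$, $n$ a positive integer, mapping each $[k,k+1]$ ($k$ an integer) isometrically onto an edge; a ray is such a map on $[0,\infty)$ and a line is such a map on $(-\infty,\infty)$. An edge path is geodesic if $d(\beta(s),\beta(t))=|s-t|$ for all integers $s,t$ in its domain. It is a $(\lambda,\epsilon)$-quasi-geodesic if $|s-t|\le\lambda d(\beta(s),\beta(t))+\epsilon$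 for all integers $s,t$ in its domain. For a vertex $t=\beta(k)$ of an edge path $\beta$, the bracket number $B(t,\beta)$ is the number of walls $Q$ such that $\beta$ has an edge of $Q$ on either side of $t$ (one at or before position $k$ and one at or after position $k$). The bracket number of $\beta$ is $B(\beta)=\max_t B(t,\beta)$ over all vertices $t$ of $\beta$ (bounded if these numbers are bounded). An edge path $\alpha$ is $K$-tracked by an edge path $\beta$ if each vertex of $\alpha$ is within distance $K$ of a vertex of $\beta$. *)

(* Defs.v *)
From mathcomp Require Import all_boot all_order all_algebra.
From mathcomp Require Import boolp classical_sets cardinality reals.

Set Implicit Arguments.
Unset Strict Implicit.
Unset Printing Implicit Defensive.

Import Order.TTheory GRing.Theory Num.Theory.

Local Open Scope classical_set_scope.
Local Open Scope ring_scope.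

(* Group presentations: the letter (i, true) stands for the generator i and
   (i, false) for its formal inverse. *)
Definition word_eval (W : groupType) (I : Type) (s : I -> W)
    (u : seq (I * bool)) : W :=
  (\prod_(x <- u) (if x.2 then s x.1 else (s x.1)^-1))%g.

(* [pres_eq rel u v]: u and v represent the same element of the quotient of the
   free group on I by the normal closure of the relators rel. *)
Inductive pres_eq (I : Type) (rel : seq (I * bool) -> Prop) :
    seq (I * bool) -> seq (I * bool) -> Prop :=
| pres_refl u : pres_eq rel u u
| pres_sym u v : pres_eq rel u v -> pres_eq rel v u
| pres_trans u v w : pres_eq rel u v -> pres_eq rel v w -> pres_eq rel u w
| pres_cancel u v i b : pres_eq rel (u ++ [:: (i, b); (i, ~~ b)] ++ v) (u ++ v)
| pres_relator u v r : rel r -> pres_eq rel (u ++ r ++ v) (u ++ v).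

Definition has_presentation (W : groupType) (I : Type) (s : I -> W)
    (rel : seq (I * bool) -> Prop) : Prop :=
  (forall w : W, exists u, word_eval s u = w) /\
  (forall u v, word_eval s u = word_eval s v <-> pres_eq rel u v).

(* In a Coxeter matrix, None stands for the value infinity. *)
Definition coxeter_matrix (I : Type) (m : I -> I -> option nat) : Prop :=
  [/\ forall i j, m i j = m j i,
      forall i j, m i j <> Some 0%N &
      forall i j, m i j = Some 1%N <-> i = j].

Definition coxeter_relator (I : Type) (m : I -> I -> option nat)
    (r : seq (I * bool)) : Prop :=
  exists i j n,
    m i j = Some n /\ r = flatten (nseq n [:: (i, true); (j, true)]).

(* The set S is the image of the injective family s. *)
Definition coxeter_system (W : groupType) (I : Type) (s : I -> W)
    (m : I -> I -> option nat) : Prop :=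
  [/\ injective s, coxeter_matrix m & has_presentation s (coxeter_relator m)].

Definition cayley_adj (W : groupType) (I : finType) (s : I -> W) : rel W :=
  fun v w => [exists i, w == (v * s i)%g].

(* The set of lengths of the paths from v to w in the Cayley graph. *)
Definition cayley_path_length (W : groupType) (I : finType) (s : I -> W)
    (v w : W) : set nat :=
  [set n | exists p : seq W,
    [/\ path (cayley_adj s) v p, last v p = w & size p = n]].

(* The path metric on vertices; the default value 0 of xget is only used for
   vertices in distinct components, and the Cayley graph is connected. *)
Definition cayley_dist (W : groupType) (I : finType) (s : I -> W)
    (v w : W) : nat :=
  xget 0%N [set n | cayley_path_length s v w n /\
                    forall k, cayley_path_length s v w k -> (n <= k)%N].

(* An edge is represented by the set of its two end vertices; distinct
   generators label distinct edges at a vertex, so there are no multi-edges. *)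
Definition edge_of (W : groupType) (v w : W) : set W := [set v; w].

Definition is_reflection (W : groupType) (I : finType) (s : I -> W)
    (r : W) : Prop :=
  exists (g : W) (i : I), r = (g * s i * g^-1)%g.

Definition wall_of (W : groupType) (I : finType) (s : I -> W) (r : W) :
    set (set W) :=
  [set e | exists v w : W, [/\ cayley_adj s v w, e = edge_of v w,
                               (r * v = w)%g & (r * w = v)%g]].

Definition is_wall (W : groupType) (I : finType) (s : I -> W)
    (Q : set (set W)) : Prop :=
  exists2 r, is_reflection s r & Q = wall_of s r.

(* An edge path is determined by its vertices at the integers of its domain;
   the values of the function outside the domain are irrelevant. *)
Definition segment_domain (D : interval int) : Prop :=
  exists2 n : nat, (0 < n)%N & D = `[0, n%:Z].
Definition ray_domain (D : interval int) : Prop := D = `[0, +oo[.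
Definition line_domain (D : interval int) : Prop := D = `]-oo, +oo[.

Definition edge_path_on (W : groupType) (I : finType) (s : I -> W)
    (D : interval int) (b : int -> W) : Prop :=
  forall k, k \in D -> k + 1 \in D -> cayley_adj s (b k) (b (k + 1)).

Definition is_edge_path (W : groupType) (I : finType) (s : I -> W)
    (D : interval int) (b : int -> W) : Prop :=
  [\/ segment_domain D, ray_domain D | line_domain D] /\ edge_path_on s D b.

Definition is_geodesic (W : groupType) (I : finType) (s : I -> W)
    (D : interval int) (b : int -> W) : Prop :=
  forall j k, j \in D -> k \in D ->
    (cayley_dist s (b j) (b k))%:Z = `|j - k|.

Definition is_quasi_geodesic (R : realType) (W : groupType) (I : finType)
    (s : I -> W) (lambda epsilon : R) (D : interval int) (b : int -> W) :
    Prop :=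
  forall j k, j \in D -> k \in D ->
    `|j - k|%:~R <= lambda * (cayley_dist s (b j) (b k))%:R + epsilon.

(* The walls having an edge of the path on either side of position k. *)
Definition bracketing_walls (W : groupType) (I : finType) (s : I -> W)
    (D : interval int) (b : int -> W) (k : int) : set (set (set W)) :=
  [set Q | [/\ is_wall s Q,
    exists j, [/\ j \in D, j + 1 <= k & Q (edge_of (b j) (b (j + 1)))] &
    exists l, [/\ k <= l, l + 1 \in D & Q (edge_of (b l) (b (l + 1)))]]].

Definition bracket_number_at (W : groupType) (I : finType) (s : I -> W)
    (D : interval int) (b : int -> W) (k : int) (n : nat) : Prop :=
  (bracketing_walls s D b k #= `I_n)%card.

(* [has_bracket_number s D b B]: the bracket numbers at the vertices of the
   path are finite, and their maximum is B. *)
Definition has_bracket_number (W : groupType) (I : finType) (s : I -> W)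
    (D : interval int) (b : int -> W) (B : nat) : Prop :=
  (forall k, k \in D -> exists2 n, bracket_number_at s D b k n & (n <= B)%N) /\
  (exists2 k, k \in D & bracket_number_at s D b k B).

Definition tracked (R : realType) (W : groupType) (I : finType) (s : I -> W)
    (K : R) (D : interval int) (a : int -> W) (D' : interval int)
    (b : int -> W) : Prop :=
  forall j, j \in D ->
    exists2 k, k \in D' & (cayley_dist s (a j) (b k))%:R <= K.

(* Main.v *)
Require Import Defs.
From mathcomp Require Import all_boot all_order all_algebra.
From mathcomp Require Import boolp classical_sets cardinality filter reals trigo.
From mathcomp Require Import zify ring lra.

(* Put the base point at the beginning of the path and let a_k be its vertices. The
   inversions of a_k that are not inversions of some later a_l are roots of walls
   bracketing a_k: there are at most B of them. If every a_k is at bounded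
   distance from a common lower bound z_k of the a_l, l >= k, in the weak order,
   and if z_k is chosen above z_(k-1), then the z_k lie on a geodesic ray.

   To find z_k, remove the bad inversions from h = a_k one at a time. If v is the
   one closest to h, then - h^-1 v is an elementary root: it dominates no other
   positive root. Let c be maximal with z_(k-1) <= c <= h and v not an inversion
   of c; then w = c^-1 h has only one left descent s_i, and - w^-1 e_i is
   elementary. Such w have bounded length because there are finitely many
   elementary roots (Brink and Howlett).

   That finiteness is proved in the geometric representation. The values of the
   form in ]-1, 1[ on pairs of roots are finite in number, since two such roots
   can be moved into one of the finitely many finite standard parabolic root
   systems. An elementary root is reached from a simple one by a chain of
   elementary roots; two members of the chain with the same form against all
   simple roots, up to truncation at -1, have form 1 against each other, and this
   forces one of them to dominate the other.

   For a line, take rays from alpha(-n) and pass to a limit. *)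

Set Implicit Arguments.
Unset Strict Implicit.
Unset Printing Implicit Defensive.

Import Order.TTheory GRing.Theory Num.Theory.

Local Open Scope classical_set_scope.
Local Open Scope ring_scope.

(** * Finiteness by covering lists, and ultrafilters on finite sets *)

Definition covered (T : eqType) (P : T -> Prop) :=
  exists L : seq T, forall x, P x -> x \in L.

Lemma covered_sub (T : eqType) (P Q : T -> Prop) :
  (forall x, P x -> Q x) -> covered Q -> covered P.
Proof. by move=> PQ [L h]; exists L => x /PQ /h. Qed.

Lemma covered_bigcup (T : eqType) (J : finType) (P : J -> T -> Prop) :
  (forall j, covered (P j)) -> covered (fun x => exists j, P j x).
Proof.
move=> /choice [L h]; exists (flatten [seq L j | j <- enum J]) => x [j /h xL].
by apply/flattenP; exists (L j) => //; apply/mapP; exists j; rewrite ?mem_enum.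
Qed.

Lemma covered_image (T U : eqType) (f : T -> U) (P : T -> Prop) (Q : U -> Prop) :
  (forall u, Q u -> exists2 x, P x & u = f x) -> covered P -> covered Q.
Proof.
move=> QP [L h]; exists (map f L) => u /QP [x /h xL ->].
exact: map_f.
Qed.

Lemma bounded_bigcup (A : Type) (f : A -> nat) (J : finType) (P : J -> A -> Prop) :
  (forall j, exists G, forall a, P j a -> (f a <= G)%N) ->
  exists G, forall a, (exists j, P j a) -> (f a <= G)%N.
Proof.
move=> /choice [G h]; exists (\max_j G j)%N => a [j /h].
by move/leq_trans; apply; apply: leq_bigmax.
Qed.

Lemma bounded_covered (A : Type) (f : A -> nat) (T : choiceType)
    (Q : T -> Prop) (P : T -> A -> Prop) :
  covered Q -> (forall x, exists G, forall a, P x a -> (f a <= G)%N) ->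
  exists G, forall a, (exists2 x, Q x & P x a) -> (f a <= G)%N.
Proof.
move=> [L hL] h.
have [G hG] := @bounded_bigcup A f (seq_sub L) (fun x => P (val x))
  (fun x => h (val x)).
by exists G => a [x /hL xL xa]; apply: hG; exists (SeqSub xL).
Qed.

Lemma ultra_covered (T : eqType) (U : set_system nat) (f : nat -> T) (P : T -> Prop) :
  UltraFilter U -> covered P -> U [set n | P (f n)] -> exists w, U [set n | f n = w].
Proof.
move=> UU [L hL] UP; have {hL}UP : U [set n | f n \in L].
  by apply: filterS UP => n /hL.
elim: L UP => [|w L IH] UL.
  by have [n] := filter_ex UL.
have [Uw|Uw] := in_ultra_setVsetC [set n | f n = w] UU; first by exists w.
apply: IH; apply: filterS (filterI UL Uw) => n [/=].
by rewrite inE => /predU1P [].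
Qed.

Section CoxeterSystem.

Variables (R : realType) (W : groupType) (I : finType) (s : I -> W).
Variable m : I -> I -> option nat.
Hypothesis hW : coxeter_system s m.

Implicit Types (g w : W) (i j t : I) (l : seq I).

(* The instances of * produced by rewriting with the library's lemmas differ
   from the ones elaborated from (x * y)%g, and lia does not unify them. *)
Let mulgA (g1 g2 g3 : W) : (g1 * (g2 * g3))%g = (g1 * g2 * g3)%g.
Proof. exact: mulgA. Qed.

Let invgM (g1 g2 : W) : (g1 * g2)^-1%g = (g2^-1 * g1^-1)%g.
Proof. exact: invgM. Qed.

(** * Words and length *)

Definition ev l : W := (\prod_(i <- l) s i)%g.

Lemma ev_nil : ev [::] = 1%g.
Proof. by rewrite /ev big_nil. Qed.

Lemma ev_cons i l : ev (i :: l) = (s i * ev l)%g.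
Proof. by rewrite /ev big_cons. Qed.

Lemma ev_cat l1 l2 : ev (l1 ++ l2) = (ev l1 * ev l2)%g.
Proof. by rewrite /ev big_cat. Qed.

Lemma ev_rcons l i : ev (rcons l i) = (ev l * s i)%g.
Proof. by rewrite -cats1 ev_cat ev_cons ev_nil mulg1. Qed.

Definition posw l : seq (I * bool) := [seq (i, true) | i <- l].

Lemma word_eval_posw l : word_eval s (posw l) = ev l.
Proof. by rewrite /word_eval /posw big_map. Qed.

Lemma relator_eval u v r : coxeter_relator m r ->
  word_eval s (u ++ r ++ v) = word_eval s (u ++ v).
Proof. by case: hW => _ _ [_ pres] hr; apply/pres/pres_relator. Qed.

Lemma gen_sqr i : (s i * s i)%g = 1%g.
Proof.
case: hW => _ [_ _ m1] _.
have hr : coxeter_relator m [:: (i, true); (i, true)].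
  by exists i, i, 1%N; split=> //; apply/m1.
move: (relator_eval [::] [::] hr).
by rewrite /word_eval /= !big_cons big_nil mulg1.
Qed.

Lemma gen_inv i : (s i)^-1%g = s i.
Proof. by apply: mulg1_eq; apply: gen_sqr. Qed.

Lemma gen_mulK i g : (s i * (s i * g))%g = g.
Proof. by rewrite mulgA gen_sqr mul1g. Qed.

Lemma mul_genK i g : (g * s i * s i)%g = g.
Proof. by rewrite -mulgA gen_sqr mulg1. Qed.

Lemma ev_inv l : (ev l)^-1%g = ev (rev l).
Proof.
elim: l => [|i l IH]; first by rewrite ev_nil invg1.
by rewrite ev_cons invgM IH gen_inv rev_cons ev_rcons.
Qed.

Lemma ev_surj w : exists l, ev l = w.
Proof.
case: hW => _ _ [surj _]; have [u <-] := surj w.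
exists [seq x.1 | x <- u]; rewrite /ev /word_eval big_map.
by apply: eq_bigr => -[i []] _ //=; rewrite gen_inv.
Qed.

(** Relators and cancelling pairs have even length. This is the sign character of W; it makes the
    length change at every multiplication by a generator. *)
Lemma pres_eq_parity u v : pres_eq (coxeter_relator m) u v ->
  odd (size u) = odd (size v).
Proof.
elim=> {u v} [u|u v _ ->|u v w _ -> _ ->|u v i b|u v r] //.
  by rewrite !size_cat !oddD.
move=> [i] [j] [n] [_ ->]; rewrite !size_cat !oddD.
suff -> : odd (size (flatten (nseq n [:: (i, true); (j, true)]))) = false by [].
by elim: n => //= n ->.
Qed.

Lemma ev_parity l1 l2 : ev l1 = ev l2 -> odd (size l1) = odd (size l2).
Proof.
rewrite -!word_eval_posw; case: hW => _ _ [_ pres] /pres /pres_eq_parity.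
by rewrite !size_map.
Qed.

Lemma len_exists w : exists n, `[< exists l, ev l = w /\ size l = n >].
Proof. by have [l <-] := ev_surj w; exists (size l); apply/asboolP; exists l. Qed.

Definition len w : nat := ex_minn (len_exists w).

Lemma reduced_word w : exists l, ev l = w /\ size l = len w.
Proof. by rewrite /len; case: ex_minnP => n /asboolP. Qed.

Lemma len_ev l : (len (ev l) <= size l)%N.
Proof.
by rewrite /len; case: ex_minnP => n _; apply; apply/asboolP; exists l.
Qed.

Lemma len1 : len 1%g = 0%N.
Proof. by apply/eqP; rewrite -leqn0 -ev_nil len_ev. Qed.

Lemma len_eq0 w : len w = 0%N -> w = 1%g.
Proof.
by have [[|i l] [<- <-]] := reduced_word w; rewrite ?ev_nil.
Qed.

Lemma len_mul g w : (len (g * w)%g <= len g + len w)%N.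
Proof.
have [l1 [<- <-]] := reduced_word g; have [l2 [<- <-]] := reduced_word w.
by rewrite -ev_cat -size_cat len_ev.
Qed.

Lemma len_inv w : len (w^-1)%g = len w.
Proof.
have le g : (len (g^-1)%g <= len g)%N.
  have [l [E <-]] := reduced_word g.
  by rewrite -E ev_inv -size_rev len_ev.
by apply/eqP; rewrite eqn_leq le -{1}(invgK w) le.
Qed.

Lemma len_gen i : (len (s i) <= 1)%N.
Proof. by have := len_ev [:: i]; rewrite ev_cons ev_nil mulg1. Qed.

Lemma len_mulS_neq w i : len (w * s i)%g != len w.
Proof.
have [l1 [<- E1]] := reduced_word w.
have [l2 [e2 E2]] := reduced_word (ev l1 * s i)%g.
apply/eqP => E; have := @ev_parity l2 (rcons l1 i).
rewrite ev_rcons => /(_ e2); rewrite size_rcons /= E1 E2 E.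
by case: odd.
Qed.

Lemma len_mulS w i :
  len (w * s i)%g = (len w).+1 \/ len w = (len (w * s i)%g).+1.
Proof.
have := len_mulS_neq w i.
have := leq_trans (len_mul w (s i)) (leq_add (leqnn _) (len_gen i)).
have := leq_trans (len_mul (w * s i)%g (s i)) (leq_add (leqnn _) (len_gen i)).
by rewrite mul_genK; lia.
Qed.

Lemma len_gt0_last w : (0 < len w)%N ->
  exists i, len w = (len (w * s i)%g).+1.
Proof.
move=> w0; have [l [E E']] := reduced_word w.
case/lastP: l => [|l i] in E E' *; first by rewrite -E' in w0.
exists i; case: (len_mulS w i) => // h; move: (len_ev l).
by rewrite -(mul_genK i (ev l)) -ev_rcons E; rewrite size_rcons in E'; lia.
Qed.

Lemma len_gt0_first w : (0 < len w)%N ->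
  exists i, len w = (len (s i * w)%g).+1.
Proof.
move=> w0; have [|i E] := @len_gt0_last w^-1%g; first by rewrite len_inv.
by exists i; rewrite -(len_inv w) E -(len_inv (_ * _)%g) invgM invgK gen_inv.
Qed.

(** * The geometric representation *)

Definition vec := 'rV[R]_#|I|.
Implicit Types (u v x y : vec) (a c : R).

Definition co v i : R := v 0 (enum_rank i).
Definition e i : vec := delta_mx 0 (enum_rank i).

Lemma coD u v i : co (u + v) i = co u i + co v i.
Proof. by rewrite /co mxE. Qed.

Lemma coN v i : co (- v) i = - co v i.
Proof. by rewrite /co mxE. Qed.

Lemma coZ a v i : co (a *: v) i = a * co v i.
Proof. by rewrite /co mxE. Qed.

Lemma co_e i j : co (e i) j = (j == i)%:R.
Proof. by rewrite /co mxE eqxx /= (inj_eq enum_rank_inj). Qed.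

Definition coE := (coD, coN, coZ, co_e).

Lemma vec_ext u v : co u =1 co v -> u = v.
Proof.
move=> E; apply/rowP => k; have := E (enum_val k).
by rewrite /co enum_valK.
Qed.

Lemma co_sum (F : I -> vec) i : co (\sum_j F j) i = \sum_j co (F j) i.
Proof. by rewrite /co summxE. Qed.

Lemma vec_decomp v : v = \sum_i co v i *: e i.
Proof.
apply: vec_ext => j; rewrite co_sum (bigD1 j) //= coZ co_e eqxx mulr1.
by rewrite big1 ?addr0 // => i /negPf ij; rewrite coZ co_e eq_sym ij mulr0.
Qed.

(** Gram matrix of the Tits form; an infinite bond gets -1, the limit of -cos (pi / n). *)
Definition bil i j : R :=
  if i == j then 1 else if m i j is Some n then - cos (pi / n%:R) else -1.

Lemma bilC i j : bil i j = bil j i.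
Proof. by case: hW => _ [mC _ _] _; rewrite /bil eq_sym mC. Qed.

Definition form u v : R := \sum_i \sum_j co u i * co v j * bil i j.

Lemma formC u v : form u v = form v u.
Proof.
rewrite /form exchange_big; apply: eq_bigr => i _; apply: eq_bigr => j _.
by rewrite bilC (mulrC (co u j)).
Qed.

Lemma formDl u v x : form (u + v) x = form u x + form v x.
Proof.
rewrite /form -big_split; apply: eq_bigr => i _; rewrite -big_split.
by apply: eq_bigr => j _; rewrite coD !mulrDl.
Qed.

Lemma formZl a u x : form (a *: u) x = a * form u x.
Proof.
rewrite /form mulr_sumr; apply: eq_bigr => i _; rewrite mulr_sumr.
by apply: eq_bigr => j _; rewrite coZ !mulrA.
Qed.

Lemma formNl u x : form (- u) x = - form u x.
Proof. by rewrite -scaleN1r formZl mulN1r. Qed.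

Lemma formDr u v x : form x (u + v) = form x u + form x v.
Proof. by rewrite formC formDl !(formC _ x). Qed.

Lemma formZr a u x : form x (a *: u) = a * form x u.
Proof. by rewrite formC formZl formC. Qed.

Lemma formNr u x : form x (- u) = - form x u.
Proof. by rewrite formC formNl formC. Qed.

Definition formE := (formDl, formNl, formZl, formDr, formNr, formZr).

Lemma form_ee i j : form (e i) (e j) = bil i j.
Proof.
rewrite /form (bigD1 i) //= (bigD1 j) //= !co_e !eqxx !mul1r.
rewrite !big1 ?addr0 // => [k /negPf ki|k /negPf kj].
  by apply: big1 => l _; rewrite co_e ki !mul0r.
by rewrite co_e kj mulr0 mul0r.
Qed.

Lemma form_e i : form (e i) (e i) = 1.
Proof. by rewrite form_ee /bil eqxx. Qed.

Lemma form_suml (F : I -> vec) x : form (\sum_i F i) x = \sum_i form (F i) x.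
Proof.
apply: (big_morph (form^~ x)) => [u v|]; first exact: formDl.
by rewrite -(scale0r 0) formZl mul0r.
Qed.

Lemma form_decomp u v : form u v = \sum_i co u i * form (e i) v.
Proof.
rewrite {1}(vec_decomp u) form_suml.
by apply: eq_bigr => i _; rewrite formZl.
Qed.

(** * Reflections and the Coxeter relations between them *)

Definition refl x v : vec := v - (2 * form v x) *: x.

Lemma reflD x u v : refl x (u + v) = refl x u + refl x v.
Proof. by apply: vec_ext => t; rewrite /refl !coE formDl; ring. Qed.

Lemma reflZ x a v : refl x (a *: v) = a *: refl x v.
Proof. by apply: vec_ext => t; rewrite /refl !coE formZl; ring. Qed.

Lemma form_refl x u v : form x x = 1 -> form (refl x u) (refl x v) = form u v.
Proof. by move=> x1; rewrite /refl !formE x1 (formC x v); ring. Qed.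

Lemma reflK x : form x x = 1 -> involutive (refl x).
Proof.
move=> x1 v; apply: vec_ext => t.
by rewrite /refl !formE !coE x1; ring.
Qed.

Lemma refl_self x : form x x = 1 -> refl x x = - x.
Proof. by move=> x1; apply: vec_ext => t; rewrite /refl x1 !coE; ring. Qed.

(** Chebyshev polynomials of the second kind, shifted so that [cheb (cos a) k] is sin (k a) / sin a.
    Being polynomial, they also cover c = 1, the infinite bond. *)
Fixpoint cheb (c : R) (k : nat) : R :=
  match k with
  | 0%N => 0
  | k'.+1 => match k' with 0%N => 1 | k''.+1 => 2 * c * cheb c k' - cheb c k'' end
  end.

Arguments cheb : simpl never.

Lemma chebSS c k : cheb c k.+2 = 2 * c * cheb c k.+1 - cheb c k.
Proof. by []. Qed.

Lemma cheb_sin a k : cheb (cos a) k * sin a = sin (a * k%:R).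
Proof.
suff: cheb (cos a) k * sin a = sin (a * k%:R) /\
      cheb (cos a) k.+1 * sin a = sin (a * k.+1%:R) by case.
elim: k => [|k [IH1 IH2]]; first by rewrite /cheb !mulr0 mulr1 mul0r mul1r sin0.
split=> //; rewrite chebSS mulrBl IH1 -(mulrA (2 * cos a)) IH2.
have -> : a * k.+2%:R = a * k.+1%:R + a by rewrite -[k.+2]addn1 natrD; ring.
have -> : a * k%:R = a * k.+1%:R - a by rewrite -[k.+1]addn1 natrD; ring.
by rewrite sinB sinD; ring.
Qed.

Lemma cheb1 k : cheb 1 k = k%:R.
Proof.
suff: cheb 1 k = k%:R /\ cheb 1 k.+1 = k.+1%:R by case.
elim: k => [|k [IH1 IH2]] //; split=> //; rewrite chebSS IH1 IH2.
by rewrite -[k.+2]addn2 -[k.+1]addn1 !natrD; ring.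
Qed.

Definition alt i j k : seq I := mkseq (fun n => if odd n then j else i) k.

Lemma altS i j k : alt i j k.+1 = rcons (alt i j k) (if odd k then j else i).
Proof. by rewrite /alt mkseqS. Qed.

Lemma alt_cons i j k : alt i j k.+1 = i :: alt j i k.
Proof.
elim: k => [//|k IH]; rewrite altS IH altS rcons_cons /=.
by case: odd.
Qed.

Lemma size_alt i j k : size (alt i j k) = k.
Proof. by rewrite size_mkseq. Qed.

Lemma rev_alt2 i j n : rev (alt j i n.*2) = flatten (nseq n [:: i; j]).
Proof. by elim: n => // n IH; rewrite doubleS !altS /= odd_double !rev_rcons IH. Qed.

Lemma alt2 i j n : alt i j n.*2 = flatten (nseq n [:: i; j]).
Proof. by elim: n => // n IH; rewrite doubleS !alt_cons IH. Qed.

Definition actw l v : vec := foldr (fun i => refl (e i)) v l.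

Lemma actw_cat l1 l2 v : actw (l1 ++ l2) v = actw l1 (actw l2 v).
Proof. by rewrite /actw foldr_cat. Qed.

Lemma actw_lin l a u v : actw l (a *: u + v) = a *: actw l u + actw l v.
Proof. by elim: l => //= i l ->; rewrite reflD reflZ. Qed.

Lemma actw_revK l v : actw (rev l) (actw l v) = v.
Proof.
elim: l v => //= i l IH v.
by rewrite rev_cons -cats1 actw_cat /= reflK ?form_e // IH.
Qed.

(** The orbit of [e i] stays in the plane of [e i] and [e j], and its coordinates obey the Chebyshev
    recurrence. *)
Lemma actw_alt i j k : actw (rev (alt j i k)) (e i) =
  cheb (- bil i j) k.+1 *: e (if odd k then j else i) +
  cheb (- bil i j) k *: e (if odd k then i else j).
Proof.
elim: k => [|k IH]; first by rewrite /cheb scale0r addr0 scale1r.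
rewrite altS rev_rcons /= -/(actw _ _) IH /=.
by case: (odd k); rewrite reflD !reflZ refl_self ?form_e //; apply: vec_ext => t;
  rewrite /refl !coE !form_ee ?(bilC j i) chebSS; ring.
Qed.

Section FiniteBond.

Variables (i j : I) (n : nat).
Hypotheses (ij : i <> j) (mij : m i j = Some n).

Lemma bond_ge2 : (1 < n)%N.
Proof.
case: hW => _ [_ m0 m1] _; case: n mij => [/m0|[|]] //.
by move/m1.
Qed.

Let th : R := pi / n%:R.

Lemma bond_bil : bil i j = - cos th.
Proof. by rewrite /bil; case: eqP => // _; rewrite mij. Qed.

Let n0 : 0 < n%:R :> R. Proof. by rewrite ltr0n ltnW // bond_ge2. Qed.

Let thn : th * n%:R = pi.
Proof. by rewrite /th mulfVK // lt0r_neq0. Qed.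

Lemma bond_sin_gt0 : 0 < sin th.
Proof.
apply: sin_gt0_pi; rewrite divr_gt0 ?pi_gt0 //= -thn ltr_pMr ?ltr1n ?bond_ge2 //.
by rewrite divr_gt0 ?pi_gt0.
Qed.

Lemma bond_cheb_ge0 k : (k <= n)%N -> 0 <= cheb (- bil i j) k.
Proof.
move=> kn; rewrite bond_bil opprK -(pmulr_lge0 _ bond_sin_gt0) cheb_sin.
have th0 : 0 <= th by rewrite divr_ge0 ?pi_ge0 // ltW.
by apply: sin_ge0_pi; rewrite mulr_ge0 //= -thn ler_wpM2l // ler_nat.
Qed.

Lemma bond_cheb2n : cheb (- bil i j) n.*2 = 0.
Proof.
apply: (mulIf (lt0r_neq0 bond_sin_gt0)).
rewrite bond_bil opprK cheb_sin mul0r -muln2 natrM mulrA thn.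
by rewrite mulr_natr sin2pi.
Qed.

Lemma bond_cheb2nS : cheb (- bil i j) n.*2.+1 = 1.
Proof.
apply: (mulIf (lt0r_neq0 bond_sin_gt0)).
rewrite bond_bil opprK cheb_sin mul1r -addn1 natrD mulrDr mulr1 -muln2 natrM.
by rewrite mulrA thn mulr_natr addrC sinD2pi.
Qed.

Lemma bond_bil_sqr : bil i j ^+ 2 != 1.
Proof.
rewrite bond_bil sqrrN cos2sin2 -subr_eq0 addrAC subrr add0r oppr_eq0.
by rewrite sqrf_eq0 lt0r_neq0 ?bond_sin_gt0.
Qed.

Lemma actw_bond_e : actw (flatten (nseq n [:: i; j])) (e i) = e i.
Proof.
rewrite -rev_alt2 actw_alt odd_double bond_cheb2n bond_cheb2nS.
by rewrite scale0r addr0 scale1r.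
Qed.

End FiniteBond.


(** The Gram determinant 1 - p^2 of x and y is nonzero, so their plane has an orthogonal complement;
    a and c solve the Gram system. *)
Lemma plane_decomp x y v : form x x = 1 -> form y y = 1 ->
  form x y ^+ 2 != 1 ->
  exists a c (z : vec), [/\ v = a *: x + c *: y + z, form z x = 0 & form z y = 0].
Proof.
move=> x1 y1; set p := form x y => p1.
have p1' : 1 - p ^+ 2 != 0 by rewrite subr_eq0 eq_sym.
pose a := (form v x - p * form v y) / (1 - p ^+ 2).
pose c := (form v y - p * form v x) / (1 - p ^+ 2).
exists a, c, (v - (a *: x + c *: y)); split.
- by rewrite addrC subrK.
- by rewrite !formE x1 (formC y) -/p /a /c; field.
- by rewrite !formE y1 -/p /a /c; field.
Qed.

Lemma refl_fix x v : form v x = 0 -> refl x v = v.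
Proof. by move=> h; rewrite /refl h mulr0 scale0r subr0. Qed.

Lemma actw_fix l v : (forall i, i \in l -> form v (e i) = 0) -> actw l v = v.
Proof.
elim: l => //= i l IH h; rewrite IH => [|k kl]; last by rewrite h // inE kl orbT.
by rewrite refl_fix // h // inE eqxx.
Qed.

(** The word fixes [e i] and [e j] by the Chebyshev values at 2n and 2n + 1, and it fixes everything
    orthogonal to both. *)
Lemma actw_relator i j n v : m i j = Some n ->
  actw (flatten (nseq n [:: i; j])) v = v.
Proof.
move=> mij; have [ij|/eqP ij] := eqVneq i j.
  elim: (n) => //= k IH; by rewrite IH ij reflK ?form_e.
set l := flatten _.
have mji : m j i = Some n by case: hW => _ [mC _ _] _; rewrite mC.
have li : actw l (e i) = e i by apply: actw_bond_e.
(* The reversed word starts with j, so it fixes [e j] by the same computation; reversal is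
   inversion. *)
have lj : actw l (e j) = e j.
  have lr : rev l = flatten (nseq n [:: j; i]).
    by rewrite /l -alt2 rev_alt2.
  rewrite -{1}(actw_bond_e (not_eq_sym ij) mji) -lr.
  by rewrite -{1}(revK l) actw_revK.
have [|a [c [z [-> zi zj]]]] := @plane_decomp (e i) (e j) v (form_e i) (form_e j).
  by rewrite form_ee; apply: bond_bil_sqr mij.
rewrite -addrA !actw_lin li lj (@actw_fix l z) // => k.
suff: {subset l <= [:: i; j]}.
  by move=> h /h; rewrite !inE => /orP[] /eqP ->.
move=> k'; rewrite /l => /flattenP [l']; rewrite mem_nseq => /andP[_ /eqP ->].
by [].
Qed.

Lemma actw_pres_eq (u u' : seq (I * bool)) : pres_eq (coxeter_relator m) u u' ->
  forall v, actw [seq p.1 | p <- u] v = actw [seq p.1 | p <- u'] v.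
Proof.
elim=> {u u'} [u|u u' _ IH|u u' u'' _ IH1 _ IH2|u u' i b|u u' r] //.
- by move=> v; rewrite IH1 IH2.
- by move=> v; rewrite !map_cat !actw_cat /= reflK ?form_e.
case=> i [j] [n] [mij ->] v; rewrite !map_cat !actw_cat; congr (actw _ _).
rewrite map_flatten map_nseq; exact: actw_relator.
Qed.

Lemma actw_ev l l' v : ev l = ev l' -> actw l v = actw l' v.
Proof.
rewrite -!word_eval_posw; case: hW => _ _ [_ pres] /pres /actw_pres_eq /(_ v).
by rewrite -!map_comp !map_id.
Qed.

(** A word for w is chosen; [actw_ev] makes the choice immaterial. *)
Definition act w v : vec := actw (projT1 (cid (ev_surj w))) v.

Lemma act_ev l v : act (ev l) v = actw l v.
Proof. by rewrite /act; case: cid => l' /= /actw_ev ->. Qed.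

Lemma act_mul g w v : act (g * w)%g v = act g (act w v).
Proof.
have [l <-] := ev_surj g; have [l' <-] := ev_surj w.
by rewrite -ev_cat !act_ev actw_cat.
Qed.

Lemma act_gen i v : act (s i) v = refl (e i) v.
Proof. by have := act_ev [:: i] v; rewrite ev_cons ev_nil mulg1. Qed.

Lemma act1 v : act 1%g v = v.
Proof. by rewrite -ev_nil act_ev. Qed.

Lemma actK g v : act g^-1%g (act g v) = v.
Proof. by rewrite -act_mul mulVg act1. Qed.

Lemma actKV g v : act g (act g^-1%g v) = v.
Proof. by rewrite -act_mul mulgV act1. Qed.

Lemma actD g u v : act g (u + v) = act g u + act g v.
Proof. by rewrite /act -{1}(scale1r u) actw_lin scale1r. Qed.

Lemma act0 g : act g 0 = 0.
Proof. by apply: (addrI (act g 0)); rewrite -actD !addr0. Qed.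

Lemma actZ g a v : act g (a *: v) = a *: act g v.
Proof. by rewrite -{1}(addr0 (a *: v)) /act actw_lin -!/(act g _) act0 addr0. Qed.

Lemma actN g v : act g (- v) = - act g v.
Proof. by rewrite -scaleN1r actZ scaleN1r. Qed.

Lemma form_act g u v : form (act g u) (act g v) = form u v.
Proof.
have [l <-] := ev_surj g; rewrite !act_ev.
by elim: l => //= i l IH; rewrite form_refl ?form_e.
Qed.

(** * Roots and inversions *)

Definition nonneg_vec v := forall t, 0 <= co v t.

Lemma ev_relator i j n : m i j = Some n -> ev (alt i j n.*2) = 1%g.
Proof.
move=> mij; have hr : coxeter_relator m (posw (alt i j n.*2)).
  exists i, j, n; split=> //.
  by rewrite alt2 /posw map_flatten map_nseq.
have := relator_eval [::] [::] hr; rewrite cats0 /= word_eval_posw => ->.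
by rewrite /word_eval big_nil.
Qed.

Lemma take_alt i j k n : (k <= n)%N -> take k (alt i j n) = alt i j k.
Proof. by move=> kn; rewrite /alt /mkseq -map_take take_iota (minn_idPl kn). Qed.

(** The first n + 1 letters of the relator of length 2n equal the inverse of the other n - 1. *)
Lemma len_long_alt i j n : m i j = Some n -> (0 < n)%N ->
  (len (ev (alt i j n.+1)) <= n.-1)%N.
Proof.
move=> mij n0; have := ev_relator mij.
rewrite -(cat_take_drop n.+1 (alt i j _)) ev_cat take_alt; last by lia.
move/mulg1_eq => E; rewrite -len_inv E (leq_trans (len_ev _)) //.
by rewrite size_drop size_alt; lia.
Qed.

(** If k letters shorten w by k, each of them shortens it by exactly one. *)
Lemma strip_alt i j w k k' : (k' <= k)%N ->
  (len (w * ev (alt j i k))%g + k = len w)%N ->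
  (len (w * ev (alt j i k'))%g + k' = len w)%N.
Proof.
move=> kk; rewrite -{1}(cat_take_drop k' (alt j i k)) take_alt // ev_cat => E.
set x := ev _ in E *; set y := ev _ in E.
have ly : (len y <= k - k')%N by rewrite (leq_trans (len_ev _)) // size_drop size_alt.
have lx : (len x <= k')%N by rewrite (leq_trans (len_ev _)) // size_alt.
have := len_mul (w * (x * y))%g y^-1; rewrite len_inv mulgA mulgK => h1.
have := len_mul (w * x)%g x^-1; rewrite len_inv mulgK => h2.
by rewrite mulgA in E; lia.
Qed.

(* Tits: stripping from w the longest alternating suffix in i and j leaves an
   element which both generators lengthen. *)
Lemma act_simple_nonneg w i : (len w < len (w * s i)%g)%N ->
  nonneg_vec (act w (e i)).
Proof.
have [n] := ubnP (len w); elim: n w i => // n IH w i /ltnSE wn wi.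
have [/eqP w0|w0] := posnP (len w).
  by rewrite (len_eq0 (eqP w0)) => t; rewrite act1 co_e ler0n.
have [j wj] := len_gt0_last w0.
have ij : i <> j by move=> E; move: wi; rewrite E wj; lia.
pose D k := (len (w * ev (alt j i k))%g + k == len w)%N.
have D1 : D 1%N by rewrite /D altS /= ev_cons ev_nil mulg1 addn1 -wj.
have Dle k : D k -> (k <= len w)%N by move/eqP <-; rewrite leq_addl.
case: (ex_maxnP (ex_intro D _ D1) Dle) => k /eqP Dk kmax {Dle}.
have k1 : (0 < k)%N by apply: kmax.
pose v := (w * ev (alt j i k))%g.
have vlt : (len v < n)%N by rewrite /v; lia.
have step t : t = (if odd k then i else j) -> (len v < len (v * s t)%g)%N.
  move=> ->; case: (len_mulS v (if odd k then i else j)) => [->//|vt].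
  have : D k.+1.
    by rewrite /D altS ev_rcons mulgA -/v; apply/eqP; rewrite /v in vt *; lia.
  by move/kmax; rewrite ltnn.
have back t : t = (if odd k then j else i) -> (len v < len (v * s t)%g)%N.
  have := strip_alt (leq_pred k) Dk; rewrite /v; move: k1 Dk.
  case: (k) => // k' _ Dk' Ek' ->.
  by move: Dk' Ek'; rewrite altS ev_rcons /= if_neg !mulgA mul_genK; lia.
have up t : t = i \/ t = j -> nonneg_vec (act v (e t)).
  move=> tij; apply: IH => //; case: (boolP (odd k)) tij => ok [] ->;
  by [apply: step; rewrite ?ok ?(negPf ok)|apply: back; rewrite ?ok ?(negPf ok)].
have -> : w = (v * ev (rev (alt j i k)))%g by rewrite /v -ev_inv mulgK.
rewrite act_mul act_ev actw_alt actD !actZ => t; rewrite !coE.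
have cpos : 0 <= cheb (- bil i j) k /\ 0 <= cheb (- bil i j) k.+1.
  case mij : (m i j) => [b|]; last first.
    rewrite /bil; case: eqP => // _; rewrite mij opprK !cheb1.
    by rewrite !ler0n.
  (* If k reached b = m(i,j), then b letters of the suffix could be traded for b - 1 letters
     representing [i :: alt j i b], making w s_i shorter than w. *)
  suff kb : (k < b)%N by split; apply: (bond_cheb_ge0 ij mij) => //; lia.
  rewrite ltnNge; apply/negP => bk.
  have b2 := bond_ge2 ij mij.
  have := len_long_alt mij (ltnW b2); rewrite alt_cons => lb.
  have Db := strip_alt bk Dk.
  have := len_mul (w * ev (alt j i b))%g (ev (i :: alt j i b))^-1.
  by rewrite len_inv ev_cons invgM mulgA mulgK gen_inv -ev_cons; lia.
case: cpos => c1 c2; rewrite addr_ge0 // mulr_ge0 //; apply: up; case: odd; auto.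
Qed.

Lemma act_simple_nonpos w i : (len (w * s i)%g < len w)%N ->
  nonneg_vec (- act w (e i)).
Proof.
move=> h; rewrite -actN -(refl_self (form_e i)) -act_gen -act_mul.
by apply: act_simple_nonneg; rewrite mul_genK.
Qed.

(** The height is linear and nonzero on roots, so its sign serves as the sign of a root. *)
Definition height v : R := \sum_t co v t.

Lemma heightD u v : height (u + v) = height u + height v.
Proof. by rewrite /height -big_split; apply: eq_bigr => t _; rewrite coD. Qed.

Lemma heightZ a v : height (a *: v) = a * height v.
Proof. by rewrite /height mulr_sumr; apply: eq_bigr => t _; rewrite coZ. Qed.

Lemma heightN v : height (- v) = - height v.
Proof. by rewrite -scaleN1r heightZ mulN1r. Qed.

Lemma height_e i : height (e i) = 1.
Proof.
rewrite /height (bigD1 i) //= co_e eqxx big1 ?addr0 // => t /negPf ti.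
by rewrite co_e ti.
Qed.

Definition root v := exists w i, v = act w (e i).

Lemma root_e i : root (e i).
Proof. by exists 1%g, i; rewrite act1. Qed.

Lemma root_act g v : root v -> root (act g v).
Proof. by case=> w [i ->]; exists (g * w)%g, i; rewrite act_mul. Qed.

Lemma root_form v : root v -> form v v = 1.
Proof. by case=> w [i ->]; rewrite form_act form_e. Qed.

Lemma rootN v : root v -> root (- v).
Proof.
case=> w [i ->]; exists (w * s i)%g, i.
by rewrite act_mul act_gen refl_self ?form_e // actN.
Qed.

Lemma nonneg_height v : nonneg_vec v -> v != 0 -> 0 < height v.
Proof.
move=> v0; apply: contraNT; rewrite -leNgt => hv.
have h0 : height v = 0 by apply/eqP; rewrite eq_le hv sumr_ge0.
apply/eqP/vec_ext => t; rewrite /co mxE -/(co v t).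
exact: (psumr_eq0P (fun i _ => v0 i) h0).
Qed.

Lemma root_neq0 v : root v -> v != 0.
Proof.
move/root_form => v1; apply/eqP => v0; move: v1; rewrite v0 -(scale0r 0) formZl.
by rewrite mul0r => /eqP; rewrite eq_sym oner_eq0.
Qed.

Lemma height_simple w i :
  (0 < height (act w (e i))) = (len w < len (w * s i)%g)%N.
Proof.
have r : root (act w (e i)) by exists w, i.
have [h|h] := ltnP (len w) (len (w * s i)%g).
  by apply: nonneg_height; [apply: act_simple_nonneg|apply: root_neq0].
have {}h : (len (w * s i)%g < len w)%N by have := len_mulS_neq w i; lia.
have := nonneg_height (act_simple_nonpos h) (root_neq0 (rootN r)).
by rewrite heightN; lra.
Qed.

Lemma root_height_neq0 v : root v -> height v != 0.
Proof.
case=> w [i ->].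
case: (len_mulS w i) => h.
  by rewrite lt0r_neq0 // height_simple h.
rewrite -(opprK (act w _)) heightN oppr_eq0 -actN -(refl_self (form_e i)).
by rewrite -act_gen -act_mul lt0r_neq0 // height_simple mul_genK h.
Qed.

Lemma root_nonneg v : root v -> 0 < height v -> nonneg_vec v.
Proof. by case=> w [i ->]; rewrite height_simple; apply: act_simple_nonneg. Qed.

Lemma root_sign v : root v -> (height v < 0) = ~~ (0 < height v).
Proof. by move/root_height_neq0 => h; rewrite -leNgt lt_neqAle h. Qed.

Lemma all_simple_pos_eq1 w : (forall i, 0 < height (act w (e i))) -> w = 1%g.
Proof.
move=> h; apply: len_eq0; apply/eqP; rewrite -leqn0 leqNgt; apply/negP.
by move/len_gt0_last => [i E]; have := h i; rewrite height_simple E; lia.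
Qed.

Lemma act_faithful g w : (forall v, act g v = act w v) -> g = w.
Proof.
move=> h; apply/esym/invg_inj/mulg1_eq.
apply: all_simple_pos_eq1 => i; rewrite act_mul -h actKV height_e.
exact: ltr01.
Qed.

(** The reflection changes only the i-th coordinate, so the others, nonnegative before and
    nonpositive after, vanish; the norm then fixes the multiple of [e i]. *)
Lemma simple_flip i v : root v -> 0 < height v ->
  height (act (s i) v) < 0 -> v = e i.
Proof.
move=> rv v0 sv; have vn := root_nonneg rv v0.
have sn : nonneg_vec (- act (s i) v).
  apply: root_nonneg; first by apply/rootN/root_act.
  by rewrite heightN oppr_gt0.
have cj j : j != i -> co v j = 0.
  move=> /negPf ji; apply/eqP; rewrite eq_le vn andbT.
  by have := sn j; rewrite act_gen /refl !coE ji mulr0 oppr0 addr0 oppr_ge0.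
have vE : v = co v i *: e i.
  apply: vec_ext => j; rewrite coZ co_e; case: (eqVneq j i) => [->|/cj ->].
    by rewrite mulr1.
  by rewrite mulr0.
have := root_form rv; have := vn i; rewrite {2 3}vE !formE form_e => c0 c1.
suff c : co v i = 1 by rewrite vE c scale1r.
nra.
Qed.

(** The positive roots of the walls separating 1 from w. *)
Definition inversion w v :=
  [/\ root v, 0 < height v & height (act w^-1%g v) < 0].

Lemma inversion_finite w : exists L : seq vec, forall v, inversion w v -> v \in L.
Proof.
have [l <-] := ev_surj w; elim: l => [|i l [L IH]].
  by exists [::] => v [_]; rewrite ev_nil invg1 act1; lra.
exists (e i :: map (act (s i)) L) => v [rv v0].
rewrite ev_cons invgM gen_inv act_mul => hv.
have rs : root (act (s i) v) by apply: root_act.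
have [s0|] := boolP (0 < height (act (s i) v)); last first.
  by rewrite -root_sign // => /(simple_flip rv v0) ->; rewrite inE eqxx.
rewrite inE; apply/orP; right; apply/mapP; exists (act (s i) v).
  by apply: IH; split.
by rewrite -act_mul gen_sqr act1.
Qed.

Lemma act_conj g i v : act (g * s i * g^-1)%g v = refl (act g (e i)) v.
Proof.
rewrite !act_mul act_gen /refl actD actN actZ actKV.
by rewrite -(form_act g) actKV.
Qed.

Lemma refl_realized v : root v -> exists r, forall x, act r x = refl v x.
Proof. by case=> g [i ->]; exists (g * s i * g^-1)%g => x; rewrite act_conj. Qed.

(** * Dominance and finite dihedral groups *)

(** The dominance relation of Brink and Howlett, here for roots of any sign; it is invariant under
    moving b and g by the same group element. *)
Definition dominates (b g : vec) :=
  forall w, height (act w b) < 0 -> height (act w g) < 0.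

(** Apply the product of the two reflections repeatedly: as p >= 1, the leading coefficient grows by
    at least 1 each time. *)
Lemma dihedral_roots_unbounded (b g : vec) n : root b -> root g ->
  1 <= form b g -> exists a c,
    [/\ root (a *: b - c *: g), 0 <= c, c + 1 <= a & n%:R <= a].
Proof.
move=> rb rg; set p := form b g => p1.
have [r1 E1] := refl_realized rb; have [r2 E2] := refl_realized rg.
elim: n => [|n [a [c [rd c0 ca na]]]].
  by exists 1, 0; rewrite scale1r scale0r subr0; split=> //; lra.
exists (2 * p * (2 * p * a - c) - a), (2 * p * a - c).
have pa : 0 <= (p - 1) * a by apply: mulr_ge0; lra.
have h1 : a + 1 <= 2 * p * a - c by lra.
have h2 : 0 <= (p - 1) * (2 * p * a - c) by apply: mulr_ge0; lra.
split; [|by lra|by nra|by rewrite -addn1 natrD; nra].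
suff <- : act r1 (act r2 (a *: b - c *: g)) =
    (2 * p * (2 * p * a - c) - a) *: b - (2 * p * a - c) *: g.
  by do 2!apply: root_act.
rewrite E1 E2; apply: vec_ext => t.
rewrite /refl !formE (root_form rb) (root_form rg) (formC g b) -/p !coE; ring.
Qed.

(* Otherwise some w1 and w2 have opposite signs on b and g, and all the roots
   a b - c g with a, c >= 0 are separated by w1 and w2; if form b g >= 1, there
   are infinitely many of these. *)
Lemma dominance (b g : vec) : root b -> root g -> 1 <= form b g ->
  dominates b g \/ dominates g b.
Proof.
move=> rb rg bg; apply: contrapT => /not_orP [/existsNP [w1] + /existsNP [w2]].
move=> /not_implyP [b1 /negP g1] /not_implyP [g2 /negP b2].
rewrite (root_sign (root_act w1 rg)) negbK in g1.
rewrite (root_sign (root_act w2 rb)) negbK in b2.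
have [L hL] := inversion_finite (w2 * w1^-1)%g.
(* M bounds the heights of the roots in L. For a >= n the root a b - c g, moved by w2, is higher
   than M but is still an inversion. *)
pose M := \sum_(v <- L) `|height v|.
have [n hn] : exists n, M < n%:R * height (act w2 b).
  exists (Num.truncn (M / height (act w2 b))).+1.
  by rewrite -ltr_pdivrMr // truncnS_gt.
have [a [c [rd c0 ca na]]] := dihedral_roots_unbounded n rb rg bg.
pose v := act w2 (a *: b - c *: g).
have hw w : height (act w (a *: b - c *: g)) =
    a * height (act w b) - c * height (act w g).
  by rewrite actD actN !actZ heightD heightN !heightZ.
have vL : v \in L.
  apply: hL; split; first exact: root_act.
    by rewrite /v hw; nra.
  by rewrite invgM invgK act_mul /v actK hw; nra.
have : `|height v| <= M.
  by rewrite /M (big_rem _ vL) /= lerDl sumr_ge0.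
rewrite leNgt => /negP; apply; apply: (lt_le_trans hn).
rewrite (le_trans _ (ler_norm _)) // /v hw.
have : n%:R * height (act w2 b) <= a * height (act w2 b).
  by apply: ler_wpM2r => //; lra.
nra.
Qed.

(** The increment drops by p f(n + 1) at each step. A positive concave sequence is nondecreasing,
    hence at least f 0, so its increments drop by at least p f(0) each time and become negative. *)
Lemma concave_not_positive (f : nat -> R) (p : R) : 0 < p ->
  (forall n, 0 < f n) -> (forall n, f n.+2 = (2 - p) * f n.+1 - f n) -> False.
Proof.
move=> p0 f0 fS.
have arch (x y : R) : 0 < y -> exists n, x < n%:R * y.
  by move=> y0; exists (Num.truncn (x / y)).+1; rewrite -ltr_pdivrMr // truncnS_gt.
have inc n : f n <= f n.+1.
  rewrite leNgt; apply/negP => dn.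
  have [k hk] := arch (f n) (f n - f n.+1) (ltac:(lra)).
  have : f (n + k)%N <= f n - k%:R * (f n - f n.+1) /\
         f (n + k).+1%N <= f (n + k)%N - (f n - f n.+1).
    elim: (k) => [|j [IH1 IH2]]; first by rewrite addn0; lra.
    rewrite addnS -natr1 fS; have := f0 (n + j).+1%N; split; nra.
  by have := f0 (n + k)%N; lra.
have ge n : f 0%N <= f n by elim: n => // n IH; apply: le_trans (inc n).
have [k hk] := arch (f 1%N - f 0%N) (p * f 0%N) (mulr_gt0 p0 (f0 _)).
have : f k.+1 - f k <= f 1%N - f 0%N - k%:R * (p * f 0%N).
  elim: (k) => [|j IH]; first by rewrite mul0r subr0.
  by rewrite fS -natr1; have := ge j.+1; nra.
by have := inc k; lra.
Qed.

Lemma injective_leaves (f : nat -> vec) (L : seq vec) : injective f ->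
  exists n0, forall n, (n0 <= n)%N -> f n \notin L.
Proof.
move=> fI; elim: L => [|x L [n0 IH]]; first by exists 0%N.
have [[n1 E]|h] := EM (exists n1, f n1 = x).
  exists (maxn n0 n1.+1) => n; rewrite geq_max => /andP[h0 h1].
  rewrite inE negb_or IH // andbT -E; apply/eqP => /fI; lia.
exists n0 => n hn; rewrite inE negb_or IH // andbT.
by apply/eqP => E; apply: h; exists n.
Qed.

Section FiniteDihedral.

Variables (b g : vec) (r1 r2 : W).
Hypotheses (rb : root b) (rg : root g) (bg : form b g ^+ 2 < 1).
Hypotheses (E1 : forall x, act r1 x = refl b x).
Hypotheses (E2 : forall x, act r2 x = refl g x).

Let p := form b g.
Let rot v := act (r1 * r2)%g v.

Let in_plane v := exists a c, v = a *: b + c *: g.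

Let rotE a c : rot (a *: b + c *: g) =
  ((4 * p ^+ 2 - 1) * a + 2 * p * c) *: b + (- (2 * p * a) - c) *: g.
Proof.
rewrite /rot act_mul E1 E2; apply: vec_ext => t.
rewrite /refl !formE (root_form rb) (root_form rg) (formC g b) -/p !coE; ring.
Qed.

Let rot_plane v : in_plane v -> in_plane (rot v).
Proof. by case=> a [c ->]; rewrite rotE; do 2!eexists. Qed.

Let iter_plane n v : in_plane v -> in_plane (iter n rot v).
Proof. by elim: n => //= n IH /IH; apply: rot_plane. Qed.

Let b_plane : in_plane b.
Proof. by exists 1, 0; rewrite scale1r scale0r addr0. Qed.

Let g_plane : in_plane g.
Proof. by exists 0, 1; rewrite scale1r scale0r add0r. Qed.

Let rot_rec v : in_plane v -> rot (rot v) = (4 * p ^+ 2 - 2) *: rot v - v.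
Proof.
by case=> a [c ->]; rewrite !rotE; apply: vec_ext => t; rewrite !coE; ring.
Qed.

Let iter_root n v : root v -> root (iter n rot v).
Proof. by elim: n => //= n IH /IH; apply: root_act. Qed.

Let rot_inj : injective rot.
Proof. by move=> u v E; rewrite -(actK (r1 * r2)%g u) -/(rot u) E actK. Qed.

Let iter_inj n : injective (iter n rot).
Proof. by elim: n => [|n IH] u v //= /rot_inj /IH. Qed.

(* Were the orbit infinite, it would eventually consist of roots of one sign,
   since the rotation changes the sign of finitely many roots; but the heights
   along the orbit satisfy a recurrence that makes a positive orbit concave and
   finally drives it below 0. *)
Let orbit_not_inj : ~ injective (fun n => iter n rot b).
Proof.
move=> oI; have [L hL] := inversion_finite (r1 * r2)^-1%g.
have [n0 h0] := injective_leaves L oI.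
have [|n1 h1] := @injective_leaves (fun n => - iter n rot b) L.
  by move=> i j /oppr_inj /oI.
pose n2 := maxn n0 n1; pose f n := height (iter (n2 + n) rot b).
have fS n : f n.+2 = (2 - (4 - 4 * p ^+ 2)) * f n.+1 - f n.
  rewrite /f !addnS /= rot_rec; last exact: iter_plane.
  by rewrite heightD heightN heightZ; ring.
have p0 : 0 < 4 - 4 * p ^+ 2 by have := bg; rewrite -/p; lra.
have rn n : root (iter n rot b) by apply: iter_root.
have inv v : root v -> 0 < height v -> height (rot v) < 0 -> v \in L.
  by move=> *; apply: hL; split=> //; rewrite invgK.
have nL n : iter (n2 + n) rot b \notin L by apply: h0; rewrite /n2; lia.
have nL' n : - iter (n2 + n) rot b \notin L by apply: h1; rewrite /n2; lia.
have pos n : 0 < f n -> 0 < f n.+1.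
  move=> fn; apply: contraNT (nL n) => h; apply: inv => //.
  by move: h; rewrite /f addnS /= -(root_sign (root_act _ (rn _))).
have neg n : f n < 0 -> f n.+1 < 0.
  move=> fn; apply: contraNT (nL' n) => h; apply: inv; first exact: rootN.
    by rewrite heightN oppr_gt0.
  rewrite /rot actN heightN oppr_lt0.
  by move: h; rewrite /f addnS /= -/(rot _) (root_sign (root_act _ (rn _))) negbK.
have [f0|f0] := ltP 0 (f 0%N).
  by apply: (concave_not_positive p0 _ fS); elim.
apply: (@concave_not_positive (fun n => - f n) _ p0).
  by move=> n; rewrite oppr_gt0; elim: n => // ; rewrite lt_neqAle root_height_neq0.
by move=> n; rewrite fS; ring.
Qed.

(** Some power of the rotation fixes b. Being an isometry of the plane, it sends g to g or to 2 p b
    - g, so its square fixes the plane; the orthogonal complement is fixed anyway. *)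
Lemma dihedral_finite_order : exists2 k, (0 < k)%N & forall v, iter k rot v = v.
Proof.
have [k k0 kb] : exists2 k, (0 < k)%N & iter k rot b = b.
  apply: contrapT => h; apply: orbit_not_inj => i j.
  wlog ij : i j / (i <= j)%N.
    by case: (leqP i j) => [|/ltnW] ij H E; [|apply/esym]; apply: H.
  move=> E; apply/eqP; rewrite eqn_leq ij leqNgt; apply/negP => ji; apply: h.
  exists (j - i)%N; first by rewrite subn_gt0.
  by apply: (@iter_inj i); rewrite -iterD subnKC // E.
have kf u v : form (iter k rot u) (iter k rot v) = form u v.
  by elim: (k) => //= n IH; rewrite form_act.
have rotD u v : iter k rot (u + v) = iter k rot u + iter k rot v.
  by elim: (k) => //= n ->; rewrite /rot actD.
have rotZ a u : iter k rot (a *: u) = a *: iter k rot u.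
  by elim: (k) => //= n ->; rewrite /rot actZ.
have p1 : p ^+ 2 != 1 by rewrite lt_eqF.
have kg : iter k rot (iter k rot g) = g.
  have [a [c E]] := iter_plane k g_plane.
  have := kf b g; have := kf g g; rewrite kb E !formE (root_form rg) (root_form rb).
  rewrite (formC g b) -/p => h1 h2.
  have : (1 - c ^+ 2) * (1 - p ^+ 2) = 0 by rewrite -h2 in h1 *; nra.
  move/eqP; rewrite mulf_eq0 [_ || (1 - p ^+ 2 == 0)]orbC subr_eq0 eq_sym.
  rewrite (negPf p1) /=.
  rewrite -{1}(expr1n _ 2) subr_sqr mulf_eq0 subr_eq0 => /orP [/eqP c1|].
    have a0 : a = 0 by rewrite -c1 in h2; lra.
    by rewrite rotD !rotZ kb E a0 -c1; apply: vec_ext => t; rewrite !coE; ring.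
  rewrite addrC addr_eq0 => /eqP c1.
  have a0 : a = 2 * p by rewrite c1 in h2; lra.
  by rewrite rotD !rotZ kb E a0 c1; apply: vec_ext => t; rewrite !coE; ring.
exists (k + k)%N; first by rewrite addn_gt0 k0.
move=> v; rewrite iterD.
have [a [c [z [-> zb zg]]]] := plane_decomp v (root_form rb) (root_form rg) p1.
have kz : iter k rot z = z.
  by elim: (k) => //= n ->; rewrite /rot act_mul E1 E2 (refl_fix zg) (refl_fix zb).
by rewrite !(rotD, rotZ) !kz kg !kb.
Qed.

End FiniteDihedral.

(** * Finiteness of the elementary roots *)

(* A functional that is positive on almost all positive roots lies in the
   interior of the Tits cone, hence can be moved to the dominant chamber. *)
Lemma dominant_translate (f : vec -> R) :
  (forall u v, f (u + v) = f u + f v) -> (forall a v, f (a *: v) = a * f v) ->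
  covered (fun v => [/\ root v, 0 < height v & f v <= 0]) ->
  exists w, (forall i, 0 <= f (act w (e i))) /\
    covered (fun v => [/\ root v, 0 < height v & f (act w v) <= 0]).
Proof.
move=> fD fZ C.
have [L hL] : covered (fun v => [/\ root v, 0 < height v & f v < 0]).
  by apply: covered_sub C => v [? ? /ltW].
(* Induct on the size of a list covering the positive roots where f is negative: if f (e i) < 0,
   composing f with s_i removes [e i] and moves the others by s_i. *)
have [n] := ubnP (size L); elim: n => // n IH in f fD fZ L hL C * => /ltnSE Ln.
have [fi|] := pselect (forall i, 0 <= f (e i)).
  exists 1%g; split=> [i|]; first by rewrite act1.
  by apply: covered_sub C => v; rewrite act1.
move/existsNP => [i /negP]; rewrite -ltNge => fi.
have eL : e i \in L by apply: hL; split=> //; rewrite ?height_e //; exact: root_e.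
pose f' v := f (act (s i) v).
have fN v : f (- v) = - f v by rewrite -scaleN1r fZ mulN1r.
have se v : act (s i) v = e i -> v = - e i.
  move=> E; rewrite -(refl_self (form_e i)) -act_gen -{1}E.
  by rewrite -act_mul gen_sqr act1.
have pos v : root v -> 0 < height v -> f' v < 0 -> 0 < height (act (s i) v).
  move=> rv v0 fv; apply: contraLR fv; rewrite -(root_sign (root_act _ rv)).
  move/(simple_flip rv v0) => ->; rewrite /f' act_gen refl_self ?form_e // fN.
  by rewrite -leNgt oppr_ge0 ltW.
have [|||||w [w0 wC]] := IH f' _ _ (map (act (s i)) (rem (e i) L)).
- by move=> u v; rewrite /f' actD fD.
- by move=> a v; rewrite /f' actZ fZ.
- move=> v [rv v0 fv].
  apply/mapP; exists (act (s i) v); last by rewrite -act_mul gen_sqr act1.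
  have := hL (act (s i) v); have := pos v rv v0 fv => sv.
  move/(_ (And3 (root_act _ rv) sv fv)); rewrite (perm_mem (perm_to_rem eL)).
  rewrite inE => /orP [/eqP /se E|//].
  by move: v0; rewrite E heightN height_e; lra.
- have [L0 h0] := C; exists (e i :: map (act (s i)) L0) => v [rv v0 fv].
  rewrite inE; have [//|/= vi] := eqVneq v (e i).
  apply/mapP; exists (act (s i) v); last by rewrite -act_mul gen_sqr act1.
  apply: h0; split=> //; first exact: root_act.
  apply: contraNT vi; rewrite -(root_sign (root_act _ rv)).
  by move/(simple_flip rv v0) ->.
- by rewrite size_map size_rem //; case: (L) eL Ln.
exists (s i * w)%g; split=> [j|]; first by rewrite act_mul; apply: w0.
by apply: covered_sub wC => v; rewrite act_mul.
Qed.

Definition supported (J : {set I}) v := forall t, t \notin J -> co v t = 0.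

Definition spherical (J : {set I}) := covered (fun v => root v /\ supported J v).

(** The height summed over the finite group generated by r1 and r2 is invariant, so it vanishes on b
    and g, yet it is positive on almost all positive roots. Once it is moved to the dominant
    chamber, its zeros among the roots are those supported on the simple roots J where it vanishes,
    and they are finite in number. *)
Lemma finite_dihedral_spherical (b g : vec) : root b -> root g ->
  form b g ^+ 2 < 1 -> exists w J,
    [/\ spherical J, supported J (act w b) & supported J (act w g)].
Proof.
move=> rb rg bg.
have [r1 E1] := refl_realized rb; have [r2 E2] := refl_realized rg.
have [k k0 kid] := dihedral_finite_order rb rg bg E1 E2.
set rot := fun v => _ in kid.
have rotD n u v : iter n rot (u + v) = iter n rot u + iter n rot v.
  by elim: n => //= n ->; rewrite /rot actD.
have rotZ n a u : iter n rot (a *: u) = a *: iter n rot u.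
  by elim: n => //= n ->; rewrite /rot actZ.
(* The sum of the height over the orbit of the finite group <r1, r2>. *)
pose orb v := \sum_(n < k) height (iter n rot v).
pose f v := orb v + orb (act r1 v).
have orbD u v : orb (u + v) = orb u + orb v.
  by rewrite /orb -big_split; apply: eq_bigr => n _; rewrite rotD heightD.
have orbZ a v : orb (a *: v) = a * orb v.
  by rewrite /orb mulr_sumr; apply: eq_bigr => n _; rewrite rotZ heightZ.
have orb_rot v : orb (rot v) = orb v.
  rewrite /orb; case: (k) k0 kid => // k' _ kid.
  rewrite big_ord_recr big_ord_recl /= addrC -iterSr kid; congr (_ + _).
  by apply: eq_bigr => n _; rewrite -iterSr.
have r1K v : act r1 (act r1 v) = v by rewrite !E1 reflK ?root_form.
have r2K v : act r2 (act r2 v) = v by rewrite !E2 reflK ?root_form.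
have f1 v : f (act r1 v) = f v by rewrite /f r1K addrC.
have rot2 v : rot (act r2 v) = act r1 v by rewrite /rot act_mul r2K.
have f2 v : f (act r2 v) = f v.
  rewrite /f -orb_rot rot2 addrC; congr (_ + _).
  by rewrite -(orb_rot v) /rot act_mul.
have fD u v : f (u + v) = f u + f v by rewrite /f actD !orbD; ring.
have fZ a v : f (a *: v) = a * f v by rewrite /f actZ !orbZ; ring.
have fN v : f (- v) = - f v by rewrite -scaleN1r fZ mulN1r.
have fb : f b = 0 by have := f1 b; rewrite E1 refl_self ?root_form // fN; lra.
have fg : f g = 0 by have := f2 g; rewrite E2 refl_self ?root_form // fN; lra.
have iterE n v : iter n rot v = act ((r1 * r2) ^+ n)%g v.
  by elim: n => [|n IH]; rewrite ?act1 //= IH expgS act_mul.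
have C : covered (fun v => [/\ root v, 0 < height v & f v <= 0]).
  have [L hL] : covered (fun v => exists n : 'I_k,
      inversion ((r1 * r2) ^+ n)^-1%g v \/ inversion ((r1 * r2) ^+ n * r1)^-1%g v).
    apply: covered_bigcup => n.
    have [L1 h1] := inversion_finite ((r1 * r2) ^+ n)^-1%g.
    have [L2 h2] := inversion_finite ((r1 * r2) ^+ n * r1)^-1%g.
    by exists (L1 ++ L2) => v [/h1|/h2]; rewrite mem_cat => ->; rewrite ?orbT.
  exists L => v [rv v0 fv]; apply: hL; apply: contrapT => h.
  have pos x : root x -> ~ height x < 0 -> 0 < height x.
    by move=> rx /negP; rewrite root_sign // negbK.
  have : 0 < f v; last by lra.
  rewrite /f /orb -big_split /=; case: (k) k0 h => // k' _ h.
  have step (n : 'I_k'.+1) :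
      0 < height (iter n rot v) + height (iter n rot (act r1 v)).
    rewrite !iterE -act_mul addr_gt0 //; apply: pos; try exact: root_act.
      by move=> hn; apply: h; exists n; left; split=> //; rewrite invgK.
    by move=> hn; apply: h; exists n; right; split=> //; rewrite invgK.
  rewrite big_ord_recl; apply: (ltr_wpDr _ (step ord0)).
  by apply: sumr_ge0 => n _; apply/ltW/(step (lift ord0 n)).
have [w [w0 [L hL]]] := dominant_translate fD fZ C.
pose J := [set i | f (act w (e i)) == 0]%SET.
have f_sum v : f (act w v) = \sum_t co v t * f (act w (e t)).
  rewrite {1}(vec_decomp v).
  apply: (big_ind2 (fun x (y : R) => f (act w x) = y)) => [|x1 y1 x2 y2|t _].
  - by rewrite act0 -(scale0r 0) fZ mul0r.
  - by rewrite actD fD => -> ->.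
  - by rewrite actZ fZ.
have supp v : root v -> f (act w v) = 0 -> supported J v.
  wlog v0 : v / 0 < height v.
    move=> H rv fv; have [|v0] := boolP (0 < height v); first by move/H; apply.
    move=> t tJ; apply: oppr_inj; rewrite oppr0 -coN; apply: H => //.
    - by rewrite heightN oppr_gt0 root_sign.
    - exact: rootN.
    - by rewrite actN fN fv oppr0.
  move=> rv; rewrite f_sum => fv t; rewrite inE => tJ.
  have vn := root_nonneg rv v0.
  have := psumr_eq0P (fun i _ => mulr_ge0 (vn i) (w0 i)) fv (i := t) isT.
  by move/eqP; rewrite mulf_eq0 (negPf tJ) orbF => /eqP.
exists w^-1%g, J; split; last 2 first.
- by apply: supp; [apply: root_act|rewrite actKV].
- by apply: supp; [apply: root_act|rewrite actKV].
exists (L ++ map -%R L) => v [rv sv].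
have fv : f (act w v) = 0.
  rewrite f_sum big1 // => t _; have [|/sv ->] := boolP (t \in J).
    by rewrite inE => /eqP ->; rewrite mulr0.
  by rewrite mul0r.
rewrite mem_cat; have [v0|v0] := boolP (0 < height v).
  by apply/orP; left; apply: hL; split; rewrite ?fv.
apply/orP; right; apply/mapP; exists (- v); last by rewrite opprK.
apply: hL; split; first exact: rootN.
  by rewrite heightN oppr_gt0 root_sign.
by rewrite actN fN fv oppr0.
Qed.

Lemma small_forms_covered :
  covered (fun a : R => exists b g : vec,
    [/\ root b, root g, a ^+ 2 < 1 & a = form b g]).
Proof.
apply: (@covered_sub _ _ (fun a => exists J, spherical J /\ exists b g : vec,
    [/\ root b, root g, supported J b, supported J g & a = form b g])).
  move=> a [b [g [rb rg a1 E]]]; rewrite E in a1 *.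
  have [w [J [sJ sb sg]]] := finite_dihedral_spherical rb rg a1.
  exists J; split=> //; exists (act w b), (act w g).
  by rewrite form_act; split=> //; apply: root_act.
apply: covered_bigcup => J; have [[L hL]|nJ] := EM (spherical J); last first.
  by exists [::] => a [].
exists [seq form x y | x <- L, y <- L] => a [_ [b [g [rb rg sb sg ->]]]].
by apply: allpairs_f; apply: hL.
Qed.

(** * Elementary roots and their chains *)

Lemma bil_le0 i j : i != j -> bil i j <= 0.
Proof.
move/eqP => ij; case mij : (m i j) => [n|]; last first.
  by rewrite /bil; case: eqP => // _; rewrite mij lerN10.
have := bond_cheb_ge0 ij mij (bond_ge2 ij mij).
by rewrite chebSS /cheb; lra.
Qed.

(** Also known as the small roots. *)
Definition elementary (b : vec) := [/\ root b, 0 < height b &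
  forall g : vec, root g -> 0 < height g -> dominates b g -> g = b].

Lemma elementary_form_lt1 (b g : vec) : elementary b -> elementary g ->
  1 <= form b g -> b = g.
Proof.
move=> [rb b0 eb] [rg g0 eg] /(dominance rb rg) [/(eb _ rg g0)|/(eg _ rb b0)] //.
Qed.

Lemma simple_elementary i : elementary (e i).
Proof.
split; rewrite ?height_e //; first exact: root_e.
move=> g rg g0 /(_ (s i)); rewrite act_gen refl_self ?form_e //.
rewrite heightN height_e => /(_ (ltac:(lra))) h; exact: simple_flip h.
Qed.

Lemma elementary_form_simple (b : vec) i : elementary b -> b <> e i ->
  form b (e i) < 1.
Proof.
move=> eb bi; rewrite ltNge; apply/negP => h; apply: bi.
exact: elementary_form_lt1 (simple_elementary i) h.
Qed.

(** Since form b b = 1 and b has nonnegative coordinates, some form b (e i) is positive. Reflecting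
    in [e i] carries dominated roots back to roots dominated by b, provided they stay positive. *)
Lemma elementary_descend (b : vec) : elementary b -> (forall i, b <> e i) ->
  exists2 i, 0 < form b (e i) < 1 & elementary (act (s i) b).
Proof.
move=> eb bn; have [rb b0 hb] := eb; have bpos := root_nonneg rb b0.
have [i fi] : exists i, 0 < form b (e i).
  apply: contrapT => /forallNP h.
  suff : form b b <= 0 by rewrite root_form //; lra.
  rewrite {1}form_decomp; apply: sumr_le0 => t _.
  rewrite mulr_ge0_le0 // formC leNgt; exact/negP.
exists i; first by rewrite fi (elementary_form_simple eb).
have rs := root_act (s i) rb.
have s0 : 0 < height (act (s i) b).
  apply: contrapT => /negP; rewrite -root_sign //.
  by move/(simple_flip rb b0); apply: bn.
split=> // g rg g0 sg.
(* The reflection in s_i b makes s_i b negative, but sends [e i] to [e i] plus a positive multiple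
   of s_i b. *)
have gi : g <> e i.
  move=> gE; have [r rE] := refl_realized rs.
  have := sg r; rewrite rE refl_self ?root_form // heightN oppr_lt0 => /(_ s0).
  rewrite gE rE /refl heightD heightN heightZ height_e.
  have -> : form (e i) (act (s i) b) = - form b (e i).
    by rewrite act_gen /refl !formE form_e formC; ring.
  by have := mulr_gt0 fi s0; lra.
have sg0 : 0 < height (act (s i) g).
  apply: contrapT => /negP; rewrite -(root_sign (root_act _ rg)).
  by move/(simple_flip rg g0).
have sK v : act (s i) (act (s i) v) = v by rewrite -act_mul gen_sqr act1.
rewrite -(sK g); congr (act _ _); apply: hb => // [|w hw]; first exact: root_act.
by rewrite -act_mul; apply: sg; rewrite act_mul sK.
Qed.

(* [x] is reached from [y] by a nonempty chain of reflections in simple roots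
   that increase depth; once the form with [e t] drops to -1 or below, it stays
   there and [e t] is not used any more. *)
Definition below x y := [/\ elementary x, elementary y,
  forall t, co y t <= co x t, height y < height x &
  forall t, form y (e t) <= -1 -> form x (e t) <= -1 /\ co x t = co y t].

Lemma below_trans x y (z : vec) : below x y -> below y z -> below x z.
Proof.
move=> [ex ey c1 h1 f1] [_ ez c2 h2 f2]; split=> //.
- by move=> t; apply: le_trans (c1 t).
- exact: lt_trans h1.
by move=> t /f2 [/f1 [? ->] ->].
Qed.

Lemma below_descend (b : vec) i : elementary b -> 0 < form b (e i) < 1 ->
  elementary (act (s i) b) -> below b (act (s i) b).
Proof.
move=> eb /andP [f0 f1] es; split=> //.
- by move=> t; rewrite act_gen /refl !coE; have := ler0n R (t == i); nra.
- by rewrite act_gen /refl heightD heightN heightZ height_e; lra.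
move=> t; have [->|ti] := eqVneq t i.
  by rewrite act_gen /refl !formE form_e; lra.
rewrite act_gen /refl !formE !coE form_ee (negPf ti) mulr0 subr0.
have := bil_le0 (i := i) (j := t); rewrite eq_sym => /(_ ti) bt h; split=> //.
have := mulr_ge0_le0 (ltW f0) bt; lra.
Qed.

(** With equal keys, d = x - y is orthogonal to [e t] wherever its coordinate at t is nonzero,
    because coordinates are frozen where the form is truncated. Hence d is isotropic, form x y = 1,
    and x = y, against the heights. *)
Lemma below_key_neq x y : below x y ->
  (fun t => Num.max (-1) (form x (e t))) <> (fun t => Num.max (-1) (form y (e t))).
Proof.
move=> [ex ey c h f] E; have [rx _ _] := ex; have [ry _ _] := ey.
have [d dE] : exists d, d = x - y by exists (x - y).
have zero t : co d t * form d (e t) = 0.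
  have := congr1 (@^~ t) E => /= Et; rewrite dE !coE formDl formNl.
  have [/f [_ ->]|yt] := leP (form y (e t)) (-1); first by rewrite subrr mul0r.
  have -> : form x (e t) = form y (e t); last by rewrite subrr mulr0.
  move: Et; rewrite (max_r (ltW yt)); case: leP => // _ E1.
  by rewrite -E1 ltxx in yt.
have dd : form d d = 0.
  by rewrite form_decomp big1 // => t _; rewrite formC zero.
have xE : x = y + d by rewrite dE addrC subrK.
have : form x y = 1.
  have := root_form rx; rewrite xE !formE (root_form ry) dd (formC d y); lra.
move=> xy; have := elementary_form_lt1 ex ey; rewrite xy lexx => /(_ isT) Exy.
by move: h; rewrite Exy ltxx.
Qed.

Lemma elementary_covered : covered elementary.
Proof.
have [Vl hV] := small_forms_covered.
(* The value -1 comes from truncation, 1 from b = [e t], and all others lie strictly between. *)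
pose Vt := [:: -1, 1 & Vl].
pose key (b : vec) : {ffun I -> 'I_(size Vt).+1} :=
  [ffun t => inord (index (Num.max (-1) (form b (e t))) Vt)].
have keyV (b : vec) t : elementary b -> Num.max (-1) (form b (e t)) \in Vt.
  move=> eb; have [rb b0 _] := eb; rewrite !inE.
  case: leP => [h|]; last by rewrite eqxx.
  have [->|/eqP bt] := eqVneq b (e t); first by rewrite form_e eqxx orbT.
  have [//|/= h1] := eqVneq (form b (e t)) (-1).
  rewrite hV ?orbT //; exists b, (e t); split=> //; first exact: root_e.
  have : -1 < form b (e t) by rewrite lt_neqAle eq_sym h1.
  by have := elementary_form_simple eb bt; nra.
have key_neq x y : below x y -> key x != key y.
  move=> xy; apply/eqP => E; apply: (below_key_neq xy); apply: funext => t.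
  have [ex ey _ _ _] := xy.
  have := congr1 (fun k : {ffun I -> 'I_(size Vt).+1} => nat_of_ord (k t)) E.
  cbv beta; rewrite !ffunE !inordK ?ltnS ?index_size //.
  by move/(congr1 (nth 0 Vt)); rewrite !nth_index ?keyV.
pose N := #|{ffun I -> 'I_(size Vt).+1}|.
pose belowb : rel vec := fun x y => `[< below x y >].
have bt : transitive belowb.
  move=> y1 x1 z1 /asboolP h1 /asboolP h2; apply/asboolP; exact: below_trans h1 h2.
have short (b : vec) (c : seq vec) : path belowb b c -> (size c < N)%N.
  rewrite path_pairwise // => pc.
  have : uniq (map key (b :: c)).
    rewrite uniq_pairwise pairwise_map; apply: sub_pairwise pc => x y.
    by move/asboolP/key_neq.
  by move/card_uniqP; rewrite size_map /= => <-; apply: max_card.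
(* An elementary root either descends to a simple one soon enough to be listed, or starts a chain of
   n steps; for n = N the latter is excluded by the number of keys. *)
have reach n : exists L : seq vec, forall b, elementary b ->
    b \in L \/ exists2 c : seq vec, path belowb b c & size c = n.
  elim: n => [|n [L IH]]; first by exists [::] => b _; right; exists [::].
  exists (map e (enum I) ++ [seq act (s i) b | i <- enum I, b <- L]) => b eb.
  rewrite mem_cat; have [[i ->]|/forallNP bn] := EM (exists i, b = e i).
    by left; rewrite map_f // mem_enum.
  have [i fi es] := elementary_descend eb bn.
  case: (IH _ es) => [bL|[c pc <-]]; [left|right].
    apply/orP; right; apply/allpairsP; exists (i, act (s i) b) => /=.
    by rewrite mem_enum -act_mul gen_sqr act1.
  exists (act (s i) b :: c) => //=; rewrite pc andbT.
  exact/asboolP/below_descend.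
have [L hL] := reach N; exists L => b /hL [//|[c /short]].
by move=> + E; rewrite E ltnn.
Qed.

(** * Elements with prescribed descents *)

Lemma inverse_image_uniq (T : {set I}) (f : I -> vec) g w :
  (forall t, t \in T -> act g^-1%g (e t) = f t) ->
  (forall t, t \in T -> act w^-1%g (e t) = f t) ->
  (forall t, t \notin T -> 0 < height (act g (act w^-1%g (e t)))) -> w = g.
Proof.
move=> gT wT wN; apply/invg_inj/esym/mulg1_eq.
apply: all_simple_pos_eq1 => t; rewrite act_mul.
by have [tT|/wN //] := boolP (t \in T); rewrite wT // -gT // actKV height_e.
Qed.

(* Fix one such u. For any other w, either w u^-1 makes no simple root negative,
   so that w = u, or w^-1 e_r is an inversion of u^-1 for some r outside T, which
   leaves finitely many values for w^-1 e_r: add r to T. *)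
Lemma prescribed_inverse_bounded n (T : {set I}) (f : I -> vec) :
  (#|~: T|%SET <= n)%N -> exists G, forall w,
    (forall t, t \in T -> act w^-1%g (e t) = f t) /\
    (forall t, t \notin T -> 0 < height (act w^-1%g (e t))) -> (len w <= G)%N.
Proof.
elim: n T f => [|n IH] T f Tn;
  (have [[u [uT uN]]|none] := EM (exists u : W,
    (forall t, t \in T -> act u^-1%g (e t) = f t) /\
    (forall t, t \notin T -> 0 < height (act u^-1%g (e t))));
  last by exists 0%N => w hw; case: none; exists w).
  exists (len u) => w [wT wN]; rewrite (inverse_image_uniq uT wT) // => t tT.
  by move: Tn; rewrite leqn0 cards_eq0 => /eqP/setP/(_ t); rewrite !inE tT.
have [G hG] : exists G, forall w, (exists r, exists2 v, inversion u^-1%g v &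
    [/\ forall t, t \in T -> act w^-1%g (e t) = f t,
        forall t, t \notin T -> 0 < height (act w^-1%g (e t)),
        r \notin T & act w^-1%g (e r) = v]) -> (len w <= G)%N.
  apply: bounded_bigcup => r; apply: bounded_covered; first exact: inversion_finite.
  move=> v; have [rT|rT] := boolP (r \in T).
    by exists 0%N => w [].
  have [|G hG] := IH (r |: T)%SET (fun t => if t == r then v else f t).
    move: Tn; rewrite (cardsD1 r) inE rT add1n ltnS.
    have -> // : (~: (r |: T) = (~: T) :\ r)%SET.
    by apply/setP => t; rewrite !inE negb_or.
  exists G => w [wT wN _ wr]; apply: hG; split=> t; rewrite !inE.
    by case: eqVneq => [->//|_] /= /wT.
  by rewrite negb_or => /andP[_ /wN].
exists (maxn G (len u)) => w [wT wN]; rewrite leq_max.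
have [h|h] := EM (exists2 r, r \notin T & height (act u (act w^-1%g (e r))) < 0).
  have [r rT hr] := h; rewrite hG //; exists r, (act w^-1%g (e r)) => //.
  by split; [exact/root_act/root_e|exact: wN|rewrite invgK].
rewrite (inverse_image_uniq uT wT) ?leqnn ?orbT // => t tT; apply: contrapT => /negP.
rewrite -root_sign; last by do 2!apply: root_act; apply: root_e.
by move=> ht; apply: h; exists t.
Qed.

Lemma single_descent_bounded : exists G, forall w i,
  (forall t, t != i -> 0 < height (act w^-1%g (e t))) ->
  elementary (- act w^-1%g (e i)) -> (len w <= G)%N.
Proof.
have [G hG] : exists G, forall w, (exists i, exists2 b, elementary b &
    (forall t, t \in [set i]%SET -> act w^-1%g (e t) = - b) /\
    (forall t, t \notin [set i]%SET -> 0 < height (act w^-1%g (e t)))) ->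
    (len w <= G)%N.
  apply: bounded_bigcup => i; apply: bounded_covered => [|b].
    exact: elementary_covered.
  exact: (@prescribed_inverse_bounded _ [set i]%SET (fun=> - b) (leqnn _)).
exists G => w i wi wb; apply: hG; exists i, (- act w^-1%g (e i)) => //.
split=> t; rewrite inE; last exact: wi.
by move/eqP ->; rewrite opprK.
Qed.

(** * Weak order *)

(** The weak order as inclusion of inversion sets; [weak_le_len] recovers additivity of lengths. *)
Definition weak_le (g h : W) := forall v, inversion g v -> inversion h v.

Lemma weak_le_trans (g h k : W) : weak_le g h -> weak_le h k -> weak_le g k.
Proof. by move=> gh hk v /gh /hk. Qed.

Lemma inversion_gen g i v : inversion (g * s i)%g v ->
  inversion g v \/ v = act g (e i).
Proof.
case=> rv v0; rewrite invgM gen_inv act_mul => hv.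
have rg := root_act g^-1%g rv.
have [h|] := boolP (0 < height (act g^-1%g v)).
  by right; rewrite -(simple_flip rg h hv) actKV.
by rewrite -root_sign //; left.
Qed.

Lemma weak_le_gen g i : 0 < height (act g (e i)) -> weak_le g (g * s i)%g.
Proof.
move=> gi v [rv v0 hv]; split=> //; rewrite invgM gen_inv act_mul.
have rg := root_act g^-1%g rv.
rewrite root_sign; last exact: root_act.
apply/negP => h; have := simple_flip (rootN rg) (i := i).
rewrite heightN oppr_gt0 actN heightN oppr_lt0 => /(_ hv h) E.
have : act g (- act g^-1%g v) = act g (e i) by rewrite E.
by rewrite actN actKV => vE; move: gi; rewrite -vE heightN; lra.
Qed.

Lemma weak_le_extend g h i : weak_le g h ->
  height (act (g^-1 * h)^-1%g (e i)) < 0 ->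
  inversion h (act g (e i)) /\ weak_le (g * s i)%g h.
Proof.
move=> gh; rewrite invgM invgK act_mul => hi.
have rg : root (act g (e i)) by apply/root_act/root_e.
suff hinv : inversion h (act g (e i)).
  by split=> // v /inversion_gen [/gh|->].
split=> //; apply: contraTT hi; rewrite -root_sign // => g0.
(* If g e_i were negative, its opposite would be an inversion of g, hence of h, against [hi]. *)
have [] := gh (- act g (e i)).
  split; [exact: rootN|by rewrite heightN oppr_gt0|].
  by rewrite actN actK heightN height_e; lra.
by move=> _ _; rewrite actN heightN oppr_lt0 -leNgt => /ltW.
Qed.

Lemma first_letter_descent w i : len w = (len (s i * w)%g).+1 ->
  height (act w^-1%g (e i)) < 0.
Proof.
move=> wi; have rw : root (act w^-1%g (e i)) by apply/root_act/root_e.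
rewrite root_sign // height_simple len_inv -(len_inv (_ * _)%g) invgM invgK.
by rewrite gen_inv wi ltnNge leqnSn.
Qed.

(** Climb from g to h through left descents of g^-1 h; by [weak_le_extend] each step stays below
    h. *)
Lemma weak_le_len g h : weak_le g h -> len h = (len g + len (g^-1 * h)%g)%N.
Proof.
have [n] := ubnP (len (g^-1 * h)%g); elim: n g => // n IH g /ltnSE gn gh.
have [E|w0] := posnP (len (g^-1 * h)%g).
  by rewrite E addn0; move/len_eq0/mulg1_eq: E; rewrite invgK => ->.
have [i wi] := len_gt0_first w0.
have wi' := first_letter_descent wi.
have [[_ g0 _] le'] := weak_le_extend gh wi'.
have E : ((g * s i)^-1 * h)%g = (s i * (g^-1 * h))%g.
  by rewrite invgM gen_inv mulgA.
have := IH (g * s i)%g; rewrite E => /(_ _ le') -> //; last by lia.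
by move: g0; rewrite height_simple; have := len_mulS g i; lia.
Qed.

(* Take v such that - h^-1 v has least depth: every root dominated by - h^-1 v
   also gives a bad inversion, and its depth is smaller. *)
Lemma minimal_bad_elementary (M : W -> Prop) h :
  let bad v := inversion h v /\ exists2 b, M b & ~ inversion b v in
  (exists v, bad v) -> exists2 v, bad v & elementary (- act h^-1%g v).
Proof.
move=> bad [v0 bad0].
pose P n := exists v w,
  [/\ bad v, height (act w (- act h^-1%g v)) < 0 & len w = n].
have exP : exists n, `[< P n >].
  exists (len h); apply/asboolP; exists v0, h; split=> //.
  by rewrite actN actKV heightN oppr_lt0; case: bad0 => -[].
case: (ex_minnP exP) => n /asboolP [v [w [bv wv wn]]] nmin.
have minP v' w' : bad v' -> height (act w' (- act h^-1%g v')) < 0 ->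
    (len w <= len w')%N.
  by move=> b' h'; rewrite wn; apply: nmin; apply/asboolP; exists v', w'.
exists v => //; have [[rv v_pos hv] [b Mb nb]] := bv.
have rb : root (- act h^-1%g v) by apply/rootN/root_act.
split; [exact: rb|by rewrite heightN oppr_gt0|move=> y ry y0 dom].
pose v' := - act h y.
have yE : y = - act h^-1%g v' by rewrite /v' actN actK opprK.
have bv' : bad v'.
  split; [split|exists b => //].
  - by apply/rootN/root_act.
  - rewrite /v' heightN oppr_gt0; apply: dom.
    by rewrite actN actKV heightN oppr_lt0.
  - by rewrite /v' actN actK heightN oppr_lt0.
  case=> _ _; have : height (act (b^-1 * h)%g y) < 0.
    apply: dom; rewrite actN heightN oppr_lt0 act_mul actKV.
    rewrite -[_ < _]negbK -root_sign; last exact: root_act.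
    by apply/negP => ?; apply: nb.
  by rewrite act_mul /v' actN heightN; lra.
have w0 : (0 < len w)%N.
  rewrite lt0n; apply/eqP => /len_eq0 E; move: wv.
  by rewrite E act1 heightN; lra.
have [i wi] := len_gt0_first w0.
have wE x : act w x = act (s i) (act (s i * w)%g x).
  by rewrite -act_mul gen_mulK.
(* As w is shortest, s_i w does not make x negative while w does, so s_i w x = e_i. This applies to
   both y and - h^-1 v, which are therefore equal. *)
have flip x v1 : bad v1 -> x = - act h^-1%g v1 -> root x ->
    height (act w x) < 0 -> act (s i * w)%g x = e i.
  move=> b1 xE rx; rewrite wE => hx; apply: simple_flip hx; first exact: root_act.
  apply: contrapT => /negP; rewrite -root_sign; last exact: root_act.
  by rewrite xE => /(minP _ _ b1); rewrite wi ltnn.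
have Ey := flip _ _ bv' yE ry (dom _ wv).
have Ev := flip _ _ bv erefl rb wv.
by rewrite -(actK (s i * w)%g y) Ey -Ev actK.
Qed.

(** Each bad inversion v costs at most G: descend from h to a longest c between g and h that avoids
    v, and recurse from c, whose bad inversions are among the remaining ones. *)
Lemma trim : exists G, forall n (L : seq vec) (M : W -> Prop) g h,
  (size L <= n)%N ->
  (forall v, inversion h v /\ (exists2 b, M b & ~ inversion b v) -> v \in L) ->
  weak_le g h -> (forall b, M b -> weak_le g b) ->
  exists f, [/\ weak_le g f, weak_le f h, forall b, M b -> weak_le f b &
    (len (f^-1 * h)%g <= n * G)%N].
Proof.
have [G hG] := single_descent_bounded; exists G.
elim=> [|n IH] L M g h Ln hL gh gM.
  exists h; split=> //; last by rewrite mulVg len1.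
  move=> b Mb v hv; apply: contrapT => nb.
  have := hL v (conj hv (ex_intro2 _ _ b Mb nb)).
  by move: Ln; rewrite leqn0 => /nilP ->.
have [ex|none] := EM (exists v,
  inversion h v /\ exists2 b, M b & ~ inversion b v); last first.
  exists h; split=> //; last by rewrite mulVg len1.
  move=> b Mb v hv; apply: contrapT => nb; apply: none.
  by exists v; split=> //; exists b.
have [v bv ev] := minimal_bad_elementary ex; have [hv [b Mb nb]] := bv.
pose Q k := exists x : W,
  [/\ weak_le g x, weak_le x h, ~ inversion x v & len x = k].
have Q0 : exists k, `[< Q k >].
  by exists (len g); apply/asboolP; exists g; split=> // /(gM b Mb).
have Qle k : `[< Q k >] -> (k <= len h)%N.
  by move=> /asboolP [x [_ /weak_le_len -> _ <-]]; apply: leq_addr.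
case: (ex_maxnP Q0 Qle) => k /asboolP [c [gc ch nc ck]] kmax.
(* A left descent t of c^-1 h extends c below h; as c is longest, the extension must acquire v, so v
   = c e_t. *)
have desc t : height (act (c^-1 * h)^-1%g (e t)) < 0 -> v = act c (e t).
  move=> /(weak_le_extend ch) [[_ c0 _] ch'].
  apply: contrapT => nv; have /kmax : `[< Q (len (c * s t)%g) >].
    apply/asboolP; exists (c * s t)%g; split=> //.
      exact: weak_le_trans (weak_le_gen c0).
    by move/inversion_gen => [].
  by move: c0; rewrite height_simple ck ltnNge => /negP.
have u0 : (0 < len (c^-1 * h)%g)%N.
  rewrite lt0n; apply/eqP => /len_eq0/mulg1_eq; rewrite invgK => E.
  by apply: nc; rewrite E.
have [i /first_letter_descent ui] := len_gt0_first u0.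
have vi := desc i ui.
have lu : (len (c^-1 * h)%g <= G)%N.
  apply: (hG _ i) => [t ti|]; last first.
    by rewrite invgM invgK act_mul -vi.
  apply: contrapT => /negP; rewrite -root_sign; last by apply/root_act/root_e.
  move/desc; rewrite vi => /(congr1 (act c^-1%g)); rewrite !actK => E.
  have := co_e i i; rewrite E co_e eqxx eq_sym (negPf ti) => /eqP.
  by rewrite eq_sym oner_eq0.
have [|x /= [hx [b' Mb' nb']]||//|f [gf fc fM lf]] := IH (rem v L) M g c.
- have vL := hL v bv; rewrite size_rem //.
  by move: Ln vL; case: (L).
- have : x \in L by apply: hL; split; [exact: ch|exists b'].
  rewrite (perm_mem (perm_to_rem (hL v bv))) inE => /orP [/eqP xv|//].
  by case: nc; rewrite -xv.
- exact: gc.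
exists f; split=> //; first exact: weak_le_trans ch.
have -> : (f^-1 * h)%g = (f^-1 * c * (c^-1 * h))%g by rewrite mulgA mulgK.
by rewrite (leq_trans (len_mul _ _)) // mulSn addnC leq_add.
Qed.

(** * Rays, walls and brackets *)

(** Concatenate reduced words for z_k^-1 z_(k+1). Lengths add along the weak order, so every prefix
    is reduced, and b n is the prefix of length n. *)
Lemma chain_geodesic (z : nat -> W) :
  (forall k, weak_le (z k) (z k.+1)) -> (forall n, exists k, n <= len (z k))%N ->
  exists b : nat -> W, [/\ forall n, exists i, b n.+1 = (b n * s i)%g,
    forall n, len (b n) = n & forall k, b (len (z k)) = z k].
Proof.
move=> zz unb; have [red redP] := choice reduced_word.
pose r := fix r k := if k is k'.+1 then r k' ++ red ((z k')^-1 * z k'.+1)%g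
                     else red (z 0%N).
have rP k : ev (r k) = z k /\ size (r k) = len (z k).
  elim: k => [|k [IH1 IH2]] /=; first exact: redP.
  have [E1 E2] := redP ((z k)^-1 * z k.+1)%g.
  by rewrite ev_cat size_cat E1 E2 IH1 IH2 mulVKg (weak_le_len (zz k)).
have pre k k' : (k <= k')%N -> exists l, r k' = r k ++ l.
  move/subnK <-; elim: (k' - k)%N => [|d [l IH]]; first by exists [::]; rewrite cats0.
  by rewrite addSn /= IH; eexists; rewrite -catA.
have /choice [K hK] n : exists k, (n <= size (r k))%N.
  by have [k hk] := unb n; exists k; have [_ ->] := rP k.
have takeP n k k' : (n <= size (r k))%N -> (n <= size (r k'))%N ->
    take n (r k) = take n (r k').
  wlog kk : k k' / (k <= k')%N.
    by case: (leqP k k') => [|/ltnW] kk H h1 h2; [|apply/esym]; apply: H.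
  by move=> h1 h2; have [l ->] := pre _ _ kk; rewrite takel_cat.
pose b n := ev (take n (r (K n))).
have bE n k : (n <= size (r k))%N -> b n = ev (take n (r k)).
  by move=> h; rewrite /b (takeP n _ k).
exists b; split.
- move=> n; have := hK n.+1; set k := K _ => nk.
  have [i _] : exists i : I, True by case: (r k) nk => // i; exists i.
  exists (nth i (r k) n); rewrite (bE _ _ nk) (bE _ _ (ltnW nk)).
  by rewrite (take_nth i) // ev_rcons.
- move=> n; have [E1 E2] := rP (K n); have := hK n.
  have := len_mul (ev (take n (r (K n)))) (ev (drop n (r (K n)))).
  rewrite -ev_cat cat_take_drop E1 -E2 /b.
  have := len_ev (drop n (r (K n))); rewrite size_drop.
  have := len_ev (take n (r (K n))); rewrite size_take_min; lia.
- by move=> k; have [E1 E2] := rP k; rewrite -E2 (bE _ k) // take_size.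
Qed.

(* [z k] is obtained by trimming [a k] down to a common lower bound of all the
   later [a q], above the previous [z k]; only the roots that the path crosses
   both before and after time k have to be removed. *)
Lemma ray_tracking : exists G, forall (B : nat) (a : nat -> W),
  (forall k, exists L : seq vec, (size L <= B)%N /\ forall v,
     inversion (a k) v -> (exists2 q, (k <= q)%N & ~ inversion (a q) v) -> v \in L) ->
  (forall n, exists k, n <= len (a k))%N ->
  exists b : nat -> W, [/\ forall n, exists i, b n.+1 = (b n * s i)%g,
    forall n, len (b n) = n &
    forall k, exists n, (len ((b n)^-1 * a k)%g <= B * G)%N].
Proof.
have [G hG] := trim; exists G => B a br unb.
(* Here p pairs a time with the previous lower bound. The condition on it sits inside the
   existential, so that F is total, with default 1. *)
have /choice [F hF] (p : nat * W) : exists z,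
    (forall q, (p.1 <= q)%N -> weak_le p.2 (a q)) ->
    [/\ weak_le p.2 z, forall q, (p.1 <= q)%N -> weak_le z (a q) &
      (len (z^-1 * a p.1)%g <= B * G)%N].
  have [h|h] := EM (forall q, (p.1 <= q)%N -> weak_le p.2 (a q)); last by exists 1%g.
  have [L [LB hL]] := br p.1.
  have [|||z [h1 h2 h3 h4]] :=
    hG B L (fun w => exists2 q, (p.1 <= q)%N & w = a q) p.2 (a p.1) LB.
  - by move=> v [hv [b [q pl ->] nb]]; apply: hL => //; exists q.
  - exact: h.
  - by move=> b [q pl ->]; apply: h.
  by exists z => _; split=> // q pl; apply: h3; exists q.
pose z := fix z k := if k is k'.+1 then F (k, z k') else F (0%N, 1%g).
have inv1 h : weak_le 1%g h by move=> v [_]; rewrite invg1 act1; lra.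
have zP k : (forall q, (k <= q)%N -> weak_le (z k) (a q)) /\
    (len ((z k)^-1 * a k)%g <= B * G)%N.
  elim: k => [|k [IH _]] /=.
    by have [|_ h1 h2] := hF (0%N, 1%g); first by move=> q _; apply: inv1.
  have [|_ h1 h2] := hF (k.+1, z k); last by split.
  by move=> q /= kl; apply: IH; apply: ltnW.
have zz k : weak_le (z k) (z k.+1).
  have [IH _] := zP k; have [|h1 _ _] := hF (k.+1, z k); last exact: h1.
  by move=> q /= kl; apply: IH; apply: ltnW.
(* The lengths of the z k are unbounded because z k stays within B G of a k. *)
have [|b [b1 b2 b3]] := chain_geodesic zz.
  move=> n; have [k hk] := unb (n + B * G)%N; exists k.
  have [h1 h2] := zP k; have := weak_le_len (h1 k (leqnn k)); lia.
exists b; split=> // k; exists (len (z k)); rewrite b3.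
by have [] := zP k.
Qed.

(** Look at the step where the sign changes: by [simple_flip], the root crossed there is v or -
    v. *)
Lemma crossing (a : nat -> W) (v : vec) k q :
  (forall n, exists i, a n.+1 = (a n * s i)%g) -> root v -> (k <= q)%N ->
  (0 < height (act (a k)^-1%g v)) != (0 < height (act (a q)^-1%g v)) ->
  exists p i, [/\ (k <= p < q)%N, a p.+1 = (a p * s i)%g &
    act (a p) (e i) = v \/ act (a p) (e i) = - v].
Proof.
move=> step rv; elim: q => [|q IH]; first by rewrite leqn0 => /eqP ->; rewrite eqxx.
rewrite leq_eqVlt => /predU1P [->|kl]; first by rewrite eqxx.
have [E|E] := eqVneq (0 < height (act (a k)^-1%g v)) (0 < height (act (a q)^-1%g v)).
  2: have [p [i [/andP[h1 h2] h3 h4]]] := IH kl E => _.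
  2: by exists p, i; rewrite h1 ltnW.
rewrite E; have [i ai] := step q; rewrite ai invgM gen_inv act_mul => h.
have rl := root_act (a q)^-1%g rv; have rs := root_act (s i) rl.
exists q, i; split=> //; first by rewrite -ltnS kl /=.
have [h0|h0] := boolP (0 < height (act (a q)^-1%g v)).
  left; rewrite -(simple_flip rl h0 (i := i)) ?actKV // root_sign //.
  by move: h; rewrite h0; case: (0 < _).
right; rewrite -(simple_flip (rootN rl) (i := i)).
- by rewrite actN actKV.
- by rewrite heightN oppr_gt0 root_sign.
- by rewrite actN heightN oppr_lt0; move: h; rewrite (negPf h0); case: (0 < _).
Qed.

(** * Path metric and walls of the Cayley graph *)

Lemma cayley_adjP (x y : W) : reflect (exists i, y = (x * s i)%g) (cayley_adj s x y).
Proof. by apply: (iffP existsP) => -[i] => [/eqP|->]; exists i. Qed.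

Lemma cayley_path_lengthP (x y : W) n :
  cayley_path_length s x y n <-> exists l, size l = n /\ y = (x * ev l)%g.
Proof.
split=> [[p [px <- <-]]|[l [<- ->]]].
  elim: p x px => [|z p IH] x /=; first by exists [::]; rewrite ev_nil mulg1.
  move=> /andP [/cayley_adjP [i ->] /IH [l [<- ->]]].
  by exists (i :: l); rewrite ev_cons mulgA.
elim: l x => [|i l IH] x; first by exists [::]; rewrite ev_nil mulg1.
have [p [h1 h2 h3]] := IH (x * s i)%g.
exists ((x * s i)%g :: p); split; rewrite /= ?h3 //.
  by rewrite h1 andbT; apply/cayley_adjP; exists i.
by rewrite h2 ev_cons mulgA.
Qed.

Lemma cayley_distE (x y : W) : cayley_dist s x y = len (x^-1 * y)%g.
Proof.
apply: xget_unique => [|k [kP kmin]].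
  split; first apply/cayley_path_lengthP.
    by have [l [E1 E2]] := reduced_word (x^-1 * y)%g; exists l; rewrite E1 mulVKg.
  by move=> k /cayley_path_lengthP [l [<- ->]]; rewrite mulKg len_ev.
have [l [E1 E2]] := reduced_word (x^-1 * y)%g.
apply/eqP; rewrite eqn_leq; apply/andP; split.
  by apply: kmin; apply/cayley_path_lengthP; exists l; rewrite E1 mulVKg.
by have /cayley_path_lengthP [l' [<- ->]] := kP; rewrite mulKg len_ev.
Qed.

Lemma wall_of_edge (g : W) i :
  wall_of s (g * s i * g^-1)%g (edge_of g (g * s i)%g).
Proof.
exists g, (g * s i)%g; split=> //; first by apply/cayley_adjP; exists i.
  by rewrite mulgVK.
by rewrite -!mulgA mulKg gen_sqr mulg1.
Qed.

Lemma wall_of_mul (r x y : W) : wall_of s r (edge_of x y) -> (r * x)%g = y.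
Proof.
case=> x' [y'] [_ E h1 h2].
have hx : edge_of x' y' x by rewrite -E; left.
have hy : edge_of x' y' y by rewrite -E; right.
have hx' : edge_of x y x' by rewrite E; left.
have hy' : edge_of x y y' by rewrite E; right.
by case: hx hy hx' hy' => -> [] -> [] E1 [] E2; rewrite ?h1 ?h2 // ?E1 ?E2.
Qed.

Lemma wall_of_conj_edge (h g : W) i :
  wall_of s (h * (g * s i * g^-1) * h^-1)%g (edge_of (h * g)%g (h * g * s i)%g).
Proof. by have := wall_of_edge (h * g)%g i; rewrite invgM !mulgA. Qed.

(** Both reflections exchange the ends of a common edge, and W acts freely on vertices. *)
Lemma wall_of_inj (h g r : W) i :
  wall_of s (h * (g * s i * g^-1) * h^-1)%g = wall_of s r ->
  (h * (g * s i * g^-1) * h^-1)%g = r.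
Proof.
move=> E; have w1 := wall_of_conj_edge h g i; have w2 := w1; rewrite E in w2.
by apply: (@mulIg _ (h * g)%g); rewrite (wall_of_mul w1) (wall_of_mul w2).
Qed.

Lemma refl_sign (v x : vec) : refl (- v) x = refl v x.
Proof. by apply: vec_ext => t; rewrite /refl !coE formNr; ring. Qed.

Lemma refl_inj (v v' : vec) : root v -> root v' -> 0 < height v ->
  0 < height v' -> (forall x, refl v x = refl v' x) -> v = v'.
Proof.
move=> rv rv' v0 v0' /(_ v); rewrite refl_self ?root_form // /refl.
set c := form v v' => E.
have vE : v = c *: v'.
  by apply: vec_ext => t; have := congr1 (co^~ t) E; rewrite !coE; lra.
suff c1 : c = 1 by rewrite vE c1 scale1r.
have : 0 < c by move: v0; rewrite vE heightZ pmulr_lgt0.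
have := root_form rv; rewrite {1 2}vE !formE (root_form rv'); nra.
Qed.

Section Bracket.

Variables (D : interval int) (alpha : int -> W) (p : int).
Hypothesis pD : forall n : nat, p + n%:Z \in D.
Hypothesis path_alpha : edge_path_on s D alpha.

Let a (n : nat) : W := ((alpha p)^-1 * alpha (p + n%:Z))%g.

Let a_step n : exists i, a n.+1 = (a n * s i)%g.
Proof.
have pS : p + n.+1%:Z = p + n%:Z + 1 by rewrite -[n.+1]addn1 PoszD addrA.
have /cayley_adjP [i E] : cayley_adj s (alpha (p + n%:Z)) (alpha (p + n%:Z + 1)).
  by apply: path_alpha; rewrite -?pS.
by exists i; rewrite /a pS E mulgA.
Qed.

(* [v] is the positive root, relative to [alpha p], of the wall [Q]. *)
Let wall_root (v : vec) (Q : set (set W)) := exists g i,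
  (act g (e i) = v \/ act g (e i) = - v) /\
  Q = wall_of s (alpha p * (g * s i * g^-1) * (alpha p)^-1)%g.

Let wall_root_inj (v v' : vec) Q : root v -> root v' -> 0 < height v ->
  0 < height v' -> wall_root v Q -> wall_root v' Q -> v = v'.
Proof.
move=> rv rv' v0 v0' [g [i [vE QE]]] [g' [i' [vE' QE']]].
apply: refl_inj => // x.
have -> : refl v x = act (g * s i * g^-1)%g x.
  by rewrite act_conj; case: vE => ->; rewrite ?refl_sign.
have -> : refl v' x = act (g' * s i' * g'^-1)%g x.
  by rewrite act_conj; case: vE' => ->; rewrite ?refl_sign.
congr (act _ _); apply: (@mulgI _ (alpha p)); apply: (@mulIg _ (alpha p)^-1%g).
by apply: wall_of_inj; rewrite -QE QE'.
Qed.

(** The path crosses the wall of such a v before time k, since v is positive at the start, and again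
    after k, since v ceases to be an inversion. So that wall brackets, and distinct positive roots
    have distinct walls. *)
Lemma bracket_roots k n : bracket_number_at s D alpha (p + k%:Z) n ->
  exists L : seq vec, (size L <= n)%N /\ forall v, inversion (a k) v ->
    (exists2 q, (k <= q)%N & ~ inversion (a q) v) -> v \in L.
Proof.
move=> /card_esym /card_set_bijP [f [_ _ fsurj]].
pose bad v := inversion (a k) v /\ exists2 q, (k <= q)%N & ~ inversion (a q) v.
(* The default 0 is taken for bracketing walls without a bad root. *)
pose F q := xget (0 : vec) [set v | bad v /\ wall_root v (f q)].
exists [seq F q | q <- iota 0 n]; split; first by rewrite size_map size_iota.
move=> v iv nv; have [rv v0 vk] := iv.
have a0 : a 0%N = 1%g by rewrite /a addr0 mulVg.
have [|j [i [/andP[_ jk] aj ej]]] := @crossing a v 0%N k a_step rv (leq0n _).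
  rewrite a0 invg1 act1 v0; move: vk.
  by rewrite root_sign => [/negPf ->|]; last exact: root_act.
have [q kq nq] := nv.
have [|j' [i' [/andP[kj' _] aj' ej']]] := @crossing a v k q a_step rv kq.
  move: vk; rewrite root_sign; last exact: root_act.
  move/negPf ->; rewrite eq_sym eqbF_neg negbK; apply: contrapT => /negP h.
  by apply: nq; split=> //; rewrite root_sign //; apply: root_act.
pose Q := wall_of s (alpha p * (a j * s i * (a j)^-1) * (alpha p)^-1)%g.
have vQ : wall_root v Q by exists (a j), i.
have alphaE q' : alpha (p + q'%:Z) = (alpha p * a q')%g by rewrite /a mulVKg.
have edge q' i1 : a q'.+1 = (a q' * s i1)%g ->
    wall_of s (alpha p * (a q' * s i1 * (a q')^-1) * (alpha p)^-1)%g
      (edge_of (alpha (p + q'%:Z)) (alpha (p + q'%:Z + 1))).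
  move=> E; rewrite -addrA -PoszD addn1 !alphaE E.
  by rewrite (mulgA (alpha p) (a q')); apply: wall_of_conj_edge.
have EQ : Q = wall_of s (alpha p * (a j' * s i' * (a j')^-1) * (alpha p)^-1)%g.
  rewrite /Q; congr (wall_of _ (_ * _ * _)%g); apply: act_faithful => x.
  by rewrite !act_conj; case: ej => ->; case: ej' => ->; rewrite ?refl_sign.
have bQ : bracketing_walls s D alpha (p + k%:Z) Q.
  split.
  - exists (alpha p * (a j * s i * (a j)^-1) * (alpha p)^-1)%g => //.
    by exists (alpha p * a j)%g, i; rewrite invgM !mulgA.
  - exists (p + j%:Z); split; [exact: pD|by lia|exact: edge].
  - exists (p + j'%:Z); split; [by lia| |by rewrite EQ; apply: edge].
    by rewrite -addrA -PoszD.
have [i0 i0n fi0] := fsurj _ bQ.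
apply/mapP; exists i0; first by rewrite mem_iota.
have : bad (F i0) /\ wall_root (F i0) (f i0).
  apply: (xgetPex 0 (P := [set v | bad v /\ wall_root v (f i0)])).
  by exists v; rewrite fi0.
by rewrite fi0 => -[[[rF F0 _] _] wF]; apply: wall_root_inj vQ wF.
Qed.

End Bracket.

(** * Tracking *)

Lemma geodesic_dist (b : nat -> W) : (forall n, exists i, b n.+1 = (b n * s i)%g) ->
  (forall n, len (b n) = n) ->
  forall (x : W) n k, (cayley_dist s (x * b n)%g (x * b k)%g)%:Z = `|n%:Z - k%:Z|.
Proof.
move=> step lb x n k; rewrite cayley_distE invgM -mulgA mulKg.
suff main n' d : len ((b n')^-1 * b (n' + d)%N)%g = d.
  have [h|h] := leqP n k.
    by have := main n (k - n)%N; rewrite subnKC // => ->; lia.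
  have := main k (n - k)%N; rewrite subnKC ?(ltnW h) //.
  by rewrite -len_inv invgM invgK => ->; lia.
apply/eqP; rewrite eqn_leq; apply/andP; split.
  elim: d => [|d IH]; first by rewrite addn0 mulVg len1.
  rewrite addnS; have [i ->] := step (n' + d)%N.
  rewrite mulgA (leq_trans (len_mul _ _)) //.
  by rewrite -addn1 leq_add ?len_gen // IH.
have := len_mul (b n') ((b n')^-1 * b (n' + d)%N)%g.
by rewrite mulVKg !lb leq_add2l.
Qed.

Lemma ball_covered n : covered (fun w => (len w <= n)%N).
Proof.
elim: n => [|n [L hL]].
  by exists [:: 1%g] => w; rewrite leqn0 inE => /eqP /len_eq0 ->.
exists (L ++ [seq (w * s i)%g | w <- L, i <- enum I]) => w.
rewrite leq_eqVlt mem_cat => /predU1P [wn|/hL -> //]; apply/orP; right.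
have [|i wi] := @len_gt0_last w; first by rewrite wn.
have wL : (w * s i)%g \in L by apply: hL; rewrite -ltnS -wi wn.
apply/allpairsP; exists ((w * s i)%g, i); split=> //=; first by rewrite mem_enum.
by rewrite mul_genK.
Qed.

Section Tracking.

Variables (lambda epsilon : R).
Hypothesis lambda_gt0 : 0 < lambda.

Lemma quasi_geodesic_far (D : interval int) (alpha : int -> W) n :
  is_quasi_geodesic s lambda epsilon D alpha -> exists N : nat,
  forall (p : int) (q : nat), (N <= q)%N -> p \in D -> p + q%:Z \in D ->
    (n <= len ((alpha p)^-1 * alpha (p + q%:Z)%R)%g)%N.
Proof.
move=> qg; exists (Num.truncn (lambda * n%:R + epsilon)).+1 => p q Nq pD qD.
have := qg _ _ pD qD; rewrite cayley_distE.
have -> : `|p - (p + q%:Z)| = q%:Z by lia.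
move=> h; rewrite leqNgt; apply/negP => dn.
have h1 : lambda * n%:R + epsilon < q%:R.
  by apply: lt_le_trans (truncnS_gt _) _; rewrite ler_nat.
have h2 : lambda * (len ((alpha p)^-1 * alpha (p + q%:Z))%g)%:R <= lambda * n%:R.
  by rewrite ler_pM2l // ler_nat ltnW.
have : q%:R <= lambda * (len ((alpha p)^-1 * alpha (p + q%:Z))%g)%:R + epsilon by [].
by lra.
Qed.

(** G does not depend on the starting point p, which allows a limit of rays for lines. *)
Lemma ray_from : exists G, forall (D : interval int) (alpha : int -> W) (p : int) B,
  (forall n : nat, p + n%:Z \in D) -> edge_path_on s D alpha ->
  is_quasi_geodesic s lambda epsilon D alpha ->
  has_bracket_number s D alpha B ->
  exists c : nat -> W, [/\ c 0%N = alpha p,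
    forall n, exists i, c n.+1 = (c n * s i)%g,
    forall n k, (cayley_dist s (c n) (c k))%:Z = `|n%:Z - k%:Z| &
    forall k : nat, exists n, (cayley_dist s (alpha (p + k%:Z)%R) (c n) <= B * G)%N].
Proof.
have [G hG] := ray_tracking; exists G => D alpha p B pD path qg [br _].
pose a (n : nat) := ((alpha p)^-1 * alpha (p + n%:Z))%g.
have [||b [b1 b2 b3]] := hG B a.
- move=> k; have [n nk nB] := br _ (pD k).
  have [L [Ln hL]] := bracket_roots pD path nk.
  by exists L; split=> //; apply: leq_trans nB.
- move=> n; have [N hN] := quasi_geodesic_far n qg.
  exists N; apply: hN => //; have := pD 0%N; by rewrite addr0.
exists (fun n => alpha p * b n)%g; split.
- by rewrite (len_eq0 (b2 0%N)) mulg1.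
- by move=> n; have [i ->] := b1 n; exists i; rewrite mulgA.
- exact: geodesic_dist.
move=> k; have [n hn] := b3 k; exists n; rewrite cayley_distE -len_inv invgM invgK.
by rewrite invgM -mulgA.
Qed.

End Tracking.

Lemma cayley_distC (x y : W) : cayley_dist s x y = cayley_dist s y x.
Proof. by rewrite !cayley_distE -len_inv invgM invgK. Qed.

Lemma cayley_dist_triangle (x y z : W) :
  (cayley_dist s x z <= cayley_dist s x y + cayley_dist s y z)%N.
Proof.
rewrite !cayley_distE (leq_trans _ (len_mul _ _)) //.
by rewrite mulgA mulgK.
Qed.

(* The limit, along an ultrafilter, of geodesics c n which pass within distance K
   of x at time o n, where o n tends to infinity. *)
Lemma geodesic_limit (c : nat -> nat -> W) (o : nat -> nat) (K : nat) (x : W) :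
  let b n (k : int) := c n `|((o n)%:Z + k)%R|%N in
  (forall n k, exists i, c n k.+1 = (c n k * s i)%g) ->
  (forall n k q, (cayley_dist s (c n k) (c n q))%:Z = `|k%:Z - q%:Z|) ->
  (forall M, exists N, forall n, (N <= n)%N -> (M <= o n)%N) ->
  (forall n, cayley_dist s x (b n 0%R) <= K)%N ->
  exists U (beta : int -> W), [/\ UltraFilter U /\ \oo `<=` U,
    forall k, U [set n | b n k = beta k],
    is_edge_path s `]-oo, +oo[ beta & is_geodesic s `]-oo, +oo[ beta].
Proof.
move=> b step geo oinf near; have [U [UU oU]] := ultraFilterLemma eventually_filter.
have Ubig M : U [set n | (M <= o n)%N].
  by have [N hN] := oinf M; apply: oU; exists N.
(* The absolute value in [b] changes nothing when |k| <= o n, which holds for U-almost all n. *)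
have bgeo n (j k : int) : (`|j|%N <= o n)%N -> (`|k| <= o n)%N ->
    (cayley_dist s (b n j) (b n k))%:Z = `|j - k|.
  by move=> hj hk; rewrite /b geo; lia.
have /choice [beta hb] k : exists w, U [set n | b n k = w].
  pose M := `|k|%N.
  (* The vertices b n k lie in a ball about x, which is finite. *)
  apply: (@ultra_covered _ U (fun n => b n k)
    (fun w => exists2 g : W, (len g <= K + M)%N & w = (x * g)%g)).
    by apply: (covered_image _ (ball_covered (K + M))) => w [g hg ->]; exists g.
  apply: filterS (Ubig M) => n /= Mn; exists (x^-1 * b n k)%g; last by rewrite mulVKg.
  rewrite -cayley_distE (leq_trans (cayley_dist_triangle _ (b n 0) _)) // leq_add //.
  by have := bgeo n 0 k (leq0n _) Mn; rewrite /M; lia.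
exists U, beta; split=> //.
- split; first by apply: Or33.
  move=> k _ _; pose M := (`|k|.+1)%N.
  have [n [[/= E1 E2] Mn]] :=
    filter_ex (filterI (filterI (hb k) (hb (k + 1))) (Ubig M)).
  rewrite -E1 -E2; apply/cayley_adjP; have [i ci] := step n `|((o n)%:Z + k)%R|%N.
  exists i; rewrite -ci /b; congr (c _ _); move: Mn; rewrite /M /=; lia.
- move=> j k _ _; pose M := (`|j| + `|k|)%N.
  have [n [[/= E1 E2] Mn]] := filter_ex (filterI (filterI (hb j) (hb k)) (Ubig M)).
  by rewrite -E1 -E2 bgeo //; move: Mn; rewrite /M /=; lia.
Qed.

(** The ray from alpha(-n) passes near alpha(0) at time o n, which tends to infinity because alpha
    is a quasi-geodesic. Recentred there, the rays have a limit line. *)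
Lemma line_tracked (lambda epsilon : R) (G : nat) (alpha : int -> W) :
  0 < lambda ->
  is_quasi_geodesic s lambda epsilon `]-oo, +oo[ alpha ->
  (forall p : int, exists c : nat -> W, [/\ c 0%N = alpha p,
    forall n, exists i, c n.+1 = (c n * s i)%g,
    forall n k, (cayley_dist s (c n) (c k))%:Z = `|n%:Z - k%:Z| &
    forall k : nat, exists n, (cayley_dist s (alpha (p + k%:Z)%R) (c n) <= G)%N]) ->
  exists beta : int -> W, [/\ is_edge_path s `]-oo, +oo[ beta,
    is_geodesic s `]-oo, +oo[ beta &
    forall j : int, exists k, (cayley_dist s (alpha j) (beta k) <= G)%N].
Proof.
move=> lambda0 qg rays.
have /choice [c hc] (n : nat) := rays (- n%:Z).
have /choice [o ho] (n : nat) : exists k, (cayley_dist s (alpha 0%R) (c n k) <= G)%N.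
  by have [_ _ _ /(_ n)] := hc n; rewrite addNr.
have oinf M : exists N, forall n, (N <= n)%N -> (M <= o n)%N.
  have [N hN] := quasi_geodesic_far lambda0 (M + G) qg; exists N => n Nn.
  have far : (M + G <= cayley_dist s (alpha (- n%:Z)%R) (alpha 0%R))%N.
    by have := hN (- n%:Z) n Nn isT isT; rewrite addNr -cayley_distE.
  have [c0 _ /(_ 0%N (o n)) geo _] := hc n; rewrite c0 in geo.
  have := cayley_dist_triangle (alpha (- n%:Z)) (c n (o n)) (alpha 0).
  by rewrite (cayley_distC (c n (o n))); have := ho n; lia.
have [||//||U [beta [[UU oU] hb edge geo]]] := @geodesic_limit c o G (alpha 0).
- by move=> n; have [] := hc n.
- by move=> n; have [] := hc n.
- by move=> n; rewrite addr0; apply: ho.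
exists beta; split=> // j; pose M := (G + cayley_dist s (alpha 0%R) (alpha j) + G)%N.
(* The ray from alpha(-n) passes near alpha(j) at a time q n. By the triangle inequality q n - o n
   is at most M in absolute value, so it is constant for U-almost all n; that constant is the
   parameter on beta. *)
have cj (n : nat) : (`|j| <= n)%N -> exists k,
    (cayley_dist s (alpha j) (c n k) <= G)%N.
  move=> jn; have [_ _ _ /(_ `|(n%:Z + j)%R|%N)] := hc n.
  by have -> : - n%:Z + `|(n%:Z + j)%R|%N%:Z = j by lia.
have /choice [q hq] (n : nat) : exists k, (`|j| <= n)%N ->
    (cayley_dist s (alpha j) (c n k) <= G)%N.
  by have [/cj [k hk]|_] := leqP `|j| n; [exists k|exists 0%N].
have Uj : U [set n | (`|j| <= n)%N] by apply: oU; exists `|j|%N.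
pose f n : int := (q n)%:Z - (o n)%:Z.
have [||k Uk] := @ultra_covered _ U f (fun k => (`|k| <= M)%N).
- exists [seq r%:Z - M%:Z | r <- iota 0 (M + M).+1] => k kM.
  apply/mapP; exists `|(k + M%:Z)%R|%N; last by lia.
  by rewrite mem_iota; lia.
- apply: filterS Uj => n /= jn; have [_ _ /(_ (o n) (q n)) g _] := hc n.
  have h1 := cayley_dist_triangle (c n (o n)) (alpha 0) (c n (q n)).
  have h2 := cayley_dist_triangle (alpha 0) (alpha j) (c n (q n)).
  rewrite (cayley_distC (c n (o n)) (alpha 0)) in h1.
  have := ho n; have := hq n jn; rewrite /f /M; lia.
exists k; have [n [[/= E1 E2] jn]] := filter_ex (filterI (filterI Uk (hb k)) Uj).
rewrite -E2 -E1 /f; have -> : `|((o n)%:Z + ((q n)%:Z - (o n)%:Z))%R|%N = q n by lia.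
exact: hq.
Qed.

End CoxeterSystem.

Theorem corollary6p1 (R : realType) (W : groupType) (I : finType)
    (s : I -> W) (m : I -> I -> option nat) (hW : coxeter_system s m)
    (lambda epsilon : R) (hlambda : 0 < lambda) (hepsilon : 0 <= epsilon)
    (B : nat) :
  exists K' : R, forall (D : interval int) (alpha : int -> W),
    (ray_domain D \/ line_domain D) ->
    is_edge_path s D alpha ->
    is_quasi_geodesic s lambda epsilon D alpha ->
    has_bracket_number s D alpha B ->
    exists (D' : interval int) (beta : int -> W),
      [/\ is_edge_path s D' beta, is_geodesic s D' beta &
          tracked s K' D alpha D' beta].
Proof.
have [G hG] := ray_from hW epsilon hlambda.
exists (B * G)%:R => D alpha DE [_ path] qg br.
case: DE => DE; rewrite DE in path qg br *.
  have [|c [c0 step geo near]] := hG _ alpha 0 B _ path qg br.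
    by move=> n; rewrite add0r in_itv.
  (* On this domain the absolute value only converts integers to naturals. *)
  exists `[0, +oo[, (fun k => c `|k|%N); split.
  - split; first by apply: Or32.
    move=> k; rewrite !in_itv /= !andbT => k0 _; apply/cayley_adjP.
    have [i E] := step `|k|%N; exists i; rewrite -E; congr (c _); lia.
  - by move=> j k; rewrite !in_itv /= !andbT => j0 k0; rewrite geo; lia.
  - move=> j; rewrite in_itv /= andbT => j0; have [n hn] := near `|j|%N.
    exists n%:Z; first by rewrite in_itv.
    by rewrite ler_nat; move: hn; rewrite add0r gez0_abs.
have [p|beta [edge geo near]] := line_tracked hW (G := (B * G)%N) hlambda qg.
  exact: (hG `]-oo, +oo[ alpha p B (fun=> isT) path qg br).
exists `]-oo, +oo[, beta; split=> // j _; have [k hk] := near j.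
by exists k; rewrite ?ler_nat.
Qed.
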